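(* Let $X$ be a proper $\mathrm{CAT}(0)$-space such that the space of directions $\Sigma_pX$ is compact for every $p \in X$, and let $f$ be a parabolic isometry of $X$. If $X$ is visible, then the set $X_f(\infty)$ of fixed points of $f$ in the ideal boundary $X(\infty)$ consists of a single point.
   Context: A metric space is proper if every closed bounded subset is compact. For $p \in X$, $\Sigma_p^*X$ is the set of minimizing geodesics from $p$ modulo the relation $\angle_p = 0$, where $\angle_p$ is the (Alexandrov) angle at $p$; the space of directions $\Sigma_pX$ is the $\angle_p$-completion of $\Sigma_p^*X$. An isometry $f$ of a complete $\mathrm{CAT}(0)$-space is elliptic if it has a fixed point in $X$; hyperbolic if there is a geodesic line in $X$ on which $f$ acts by a non-trivial translation; parabolic if it is neither elliptic nor hyperbolic (equivalently, the displacement function $d_f(p) = d(p,f(p))$ does not attain its infimum in $X$). The ideal boundary $X(\infty)$ is the set of asymptotic classes of rays $[0,\infty) \to X$; isometries of $X$ act on it. For $x,y \in X(\infty)$, $\angle(x,y) := \sup_{p \in X} \angle_p(x,y)$, where $\angle_p(x,y)$ is the angle at $p$ between the unique rays from $p$ to $x$ and from $p$ to $y$. The Tits metric $Td$ is the interior (length) metric on $X(\infty)$ induced from $\angle$; it may take the value $\infty$. $X$ is visible if and only if $Td(x,y) = \infty$ for any distinct $x,y \in X(\infty)$. *)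

(* Defs.v *)
From HB Require Import structures.
From mathcomp Require Import all_boot all_order all_algebra generic_quotient.
From mathcomp Require Import all_classical all_reals all_analysis.
From mathcomp Require Import ring lra.

Set Implicit Arguments.
Unset Strict Implicit.
Unset Printing Implicit Defensive.

Import Order.TTheory GRing.Theory Num.Theory.
Import numFieldNormedType.Exports.

Local Open Scope classical_set_scope.
Local Open Scope quotient_scope.
Local Open Scope ring_scope.

Section isometric_curves.
Context {R : realType} {X : metricType R}.

Definition isometric_on (A : set R) (c : R -> X) : Prop :=
  forall s t, A s -> A t -> mdist (c s) (c t) = `|s - t|.

Definition is_geodesic (x y : X) (l : R) (c : R -> X) : Prop :=
  [/\ 0 <= l, isometric_on `[0, l] c, c 0 = x & c l = y].

Definition is_line (c : R -> X) : Prop := isometric_on setT c.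

Definition on_geodesic (x y p : X) : Prop :=
  exists l c t, [/\ is_geodesic x y l c, t \in `[0, l] & p = c t].

End isometric_curves.

Definition proper_space (R : realType) (X : metricType R) : Prop :=
  forall (A : set X) (p : X) (r : R), closed A -> A `<=` ball p r -> compact A.

(* The norm of the product space R * R is the sup norm, hence this one. *)
Definition euclid2 (R : realType) (u v : R * R) : R :=
  Num.sqrt ((u.1 - v.1) ^+ 2 + (u.2 - v.2) ^+ 2).

(* The points p and q of a geodesic triangle may be assumed to lie on the two
   sides issuing from x, since x, y, z are arbitrary. The points a, b, c are the
   vertices of a comparison triangle; u and v are the points of its sides [a, b]
   and [a, c] corresponding to p and q. *)
Definition CAT0 (R : realType) (X : metricType R) : Prop :=
  (forall x y : X, exists l c, is_geodesic x y l c) /\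
  (forall x y z p q : X, on_geodesic x y p -> on_geodesic x z q ->
   forall a b c u v : R * R,
     euclid2 a b = mdist x y -> euclid2 b c = mdist y z ->
     euclid2 a c = mdist x z ->
     euclid2 a u = mdist x p -> euclid2 u b = mdist p y ->
     euclid2 a v = mdist x q -> euclid2 v c = mdist q z ->
     mdist p q <= euclid2 u v).

Section angle.
Context {R : realType} {X : metricType R}.

Definition comparison_angle (p x y : X) : R :=
  acos ((mdist p x ^+ 2 + mdist p y ^+ 2 - mdist x y ^+ 2) /
        (2 * mdist p x * mdist p y)).

(* Alexandrov angle, at c 0 = c' 0, of two geodesics. The upper limit lies in
   [0, pi], so that fine loses nothing. *)
Definition angle (c c' : R -> X) : R :=
  fine (limf_esup
    (fun st : R * R => (comparison_angle (c 0) (c st.1) (c' st.2))%:E)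
    (filter_prod 0^'+ 0^'+)).

End angle.

Section pseudo_distance.
Context {R : realType}.

Record pseudo_distance (T : Type) := PseudoDistance {
  pdist :> T -> T -> R ;
  pdistxx : forall x, pdist x x = 0 ;
  pdist_sym : forall x y, pdist x y = pdist y x ;
  pdist_triangle : forall y x z, pdist x z <= pdist x y + pdist y z }.

Variables (T : choiceType) (d : pseudo_distance T).

Definition pdist_eq0 : rel T := fun x y => d x y == 0.

Lemma pdist_ge0 x y : 0 <= d x y.
Proof.
have := pdist_triangle d y x x; rewrite pdistxx (pdist_sym d y x) -mulr2n.
by rewrite pmulrn_lge0.
Qed.

Lemma pdist_eq0_equiv : equiv_class_of pdist_eq0.
Proof.
split; rewrite /pdist_eq0.
- by move=> x; rewrite pdistxx.
- by move=> x y; rewrite pdist_sym.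
- move=> y x z /eqP xy /eqP yz; rewrite eq_le pdist_ge0 andbT.
  by rewrite (le_trans (pdist_triangle d y x z))// xy yz addr0.
Qed.

Canonical pdist_eq0_equiv_rel := EquivRelPack pdist_eq0_equiv.

Definition metric_quotient := {eq_quot pdist_eq0_equiv_rel}.

HB.instance Definition _ := Choice.on metric_quotient.
HB.instance Definition _ := EqQuotient.on metric_quotient.

Definition quot_dist (x y : metric_quotient) : R := d (repr x) (repr y).

Let quot_distxx x : quot_dist x x = 0.
Proof. exact: pdistxx. Qed.

Let quot_dist_positivity x y : quot_dist x y = 0 -> x = y.
Proof.
move=> /eqP xy; rewrite -(reprK x) -(reprK y); apply/eqP.
by rewrite piE.
Qed.

Let quot_dist_sym x y : quot_dist x y = quot_dist y x.
Proof. exact: pdist_sym. Qed.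

Let quot_dist_triangle y x z : quot_dist x z <= quot_dist x y + quot_dist y z.
Proof. exact: pdist_triangle. Qed.

HB.instance Definition _ := isMetric.Build R metric_quotient
  quot_distxx quot_dist_positivity quot_dist_sym quot_dist_triangle.

End pseudo_distance.

Section completion.
Context {R : realType} (M : metricType R).

Record cauchy_seq := CauchySeq {
  cauchy_fun :> nat -> M ;
  cauchy_seqP : cauchy (cauchy_fun @ \oo) }.

HB.instance Definition _ := gen_eqMixin cauchy_seq.
HB.instance Definition _ := gen_choiceMixin cauchy_seq.

Definition cauchy_dist (u v : cauchy_seq) : R :=
  limn (fun n => mdist (u n) (v n)).

Let is_cvg_cauchy_dist (u v : cauchy_seq) :
  cvgn (fun n => mdist (u n) (v n)).
Proof.
apply/cauchy_cvgP/cauchy_ballP => e e0.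
have e20 : 0 < e / 2 by rewrite divr_gt0.
have := @cauchy_seqP u; rewrite -cauchy_ballP => /(_ _ e20).
have := @cauchy_seqP v; rewrite -cauchy_ballP => /(_ _ e20).
move=> [/= [A B] [/= nA nB] AB] [/= [C D] [/= nC nD] CD].
exists ((fun n => mdist (u n) (v n)) @` ((v @^-1` A) `&` (u @^-1` C)),
        (fun n => mdist (u n) (v n)) @` ((v @^-1` B) `&` (u @^-1` D))) => /=.
  split.
    apply: (@filterS _ _ _ ((v @^-1` A) `&` (u @^-1` C))); first by move=> n ?; exists n.
    exact: filterI.
  apply: (@filterS _ _ _ ((v @^-1` B) `&` (u @^-1` D))); first by move=> n ?; exists n.
  exact: filterI.
move=> [_ _] /= [[n [An Cn] <-] [m [Bm Dm] <-]].
have := AB (v n, v m) (conj An Bm); have := CD (u n, u m) (conj Cn Dm).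
rewrite /= !ballEmdist /= => du dv.
have h1 := metric_triangle (u n) (u m) (v n).
have h2 := metric_triangle (u m) (v m) (v n).
have h3 := metric_triangle (u m) (u n) (v m).
have h4 := metric_triangle (u n) (v n) (v m).
have h5 := metric_sym (u n) (u m).
have h6 := metric_sym (v n) (v m).
rewrite /ball/= ltr_norml; lra.
Qed.

Let cauchy_distxx u : cauchy_dist u u = 0.
Proof.
rewrite /cauchy_dist (_ : (fun n => _) = cst 0) ?lim_cst//.
by apply/funext => n; rewrite mdistxx.
Qed.

Let cauchy_dist_sym u v : cauchy_dist u v = cauchy_dist v u.
Proof. by congr (limn _); apply/funext => n; rewrite metric_sym. Qed.

Let cauchy_dist_triangle v u w :
  cauchy_dist u w <= cauchy_dist u v + cauchy_dist v w.
Proof.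
rewrite /cauchy_dist -limD//; apply: ler_lim => //.
  exact: is_cvgD.
by near=> n; exact: metric_triangle.
Unshelve. all: by end_near. Qed.

Definition cauchy_pseudo_distance : pseudo_distance cauchy_seq :=
  PseudoDistance cauchy_distxx cauchy_dist_sym cauchy_dist_triangle.

Definition completion : metricType R := metric_quotient cauchy_pseudo_distance.

End completion.

Section directions.
Context {R : realType} {X : metricType R}.

Record geodesic_from (p : X) := GeodesicFrom {
  geo_fun :> R -> X ;
  geo_length : R ;
  geo_length_gt0 : 0 < geo_length ;
  geo_start : geo_fun 0 = p ;
  geo_isometric : isometric_on `[0, geo_length] geo_fun }.

HB.instance Definition _ p := gen_eqMixin (geodesic_from p).
HB.instance Definition _ p := gen_choiceMixin (geodesic_from p).

Section angle_pseudo_distance.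
Variable p : X.
Implicit Types c : geodesic_from p.

Let F : set_system (R * R) := filter_prod 0^'+ 0^'+.
Let ca c c' (st : R * R) := comparison_angle (c 0) (c st.1) (c' st.2).

Let geo_dist c s : 0 < s < geo_length c -> mdist (c 0) (c s) = s.
Proof.
move=> /andP[s0 sl]; rewrite (geo_isometric (g := c)) ?sub0r ?normrN ?gtr0_norm//=.
  by rewrite in_itv/= lexx (ltW (geo_length_gt0 c)).
by rewrite in_itv/= !ltW.
Qed.

Let caP c c' s t : 0 < s < geo_length c -> 0 < t < geo_length c' ->
  [/\ 0 <= ca c c' (s, t), ca c c' (s, t) <= pi &
   mdist (c s) (c' t) ^+ 2 = s ^+ 2 + t ^+ 2 - 2 * s * t * cos (ca c c' (s, t))].
Proof.
move=> sl tl; rewrite /ca /comparison_angle /=.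
have ds := geo_dist sl; have dt := geo_dist tl.
have e0 : c 0 = c' 0 by rewrite !geo_start.
rewrite ds e0 dt.
case/andP: sl => s0 _; case/andP: tl => t0 _.
have h1 := metric_triangle (c s) (c 0) (c' t).
have h2 := metric_triangle (c 0) (c s) (c' t).
have h3 := metric_triangle (c 0) (c' t) (c s).
rewrite (metric_sym (c s) (c 0)) (metric_sym (c' t) (c s)) in h1 h3.
rewrite e0 dt -e0 ds in h1 h2 h3.
set D := mdist (c s) (c' t) in h1 h2 h3 *.
have D0 : 0 <= D by exact: mdist_ge0.
have st0 : 0 < 2 * s * t by rewrite !mulr_gt0.
have B : -1 <= (s ^+ 2 + t ^+ 2 - D ^+ 2) / (2 * s * t) <= 1.
  by rewrite ler_pdivlMr// ler_pdivrMr//; apply/andP; split; nra.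
split; [exact: acos_ge0|exact: acos_lepi|].
rewrite acosK ?in_itv//=; field.
by rewrite !gt_eqF.
Qed.

Let caC c c' s t : ca c c' (s, t) = ca c' c (t, s).
Proof.
rewrite /ca /comparison_angle /= !geo_start (metric_sym (c s)).
by congr acos; rewrite (addrC (_ ^+ 2)) mulrAC.
Qed.

Let F_near (e : R) : 0 < e -> F [set st | 0 < st.1 < e /\ 0 < st.2 < e].
Proof.
move=> e0; exists ([set s | 0 < s < e], [set s | 0 < s < e]) => //=.
have H : 0^'+ [set s : R | 0 < s < e].
  near=> s; apply/andP; split; near: s; first exact: nbhs_right_gt.
  exact: nbhs_right_lt.
by split.
Unshelve. all: by end_near. Qed.

Let F_small (V : set (R * R)) : F V -> exists2 e : R, 0 < e &
  forall s t, 0 < s < e -> 0 < t < e -> V (s, t).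
Proof.
move=> [[A B] /= [[a /= a0 aA] [b /= b0 bB]] AB].
exists (Num.min a b); first by rewrite lt_min a0 b0.
move=> s t /andP[s0]; rewrite lt_min => /andP[sa sb].
move=> /andP[t0]; rewrite lt_min => /andP[ta tb].
apply: AB; split => /=.
  by apply: aA => //=; rewrite sub0r normrN gtr0_norm.
by apply: bB => //=; rewrite sub0r normrN gtr0_norm.
Qed.

Let angle_fin c c' : (limf_esup (EFin \o ca c c') F) \is a fin_num.
Proof.
pose m := Num.min (geo_length c) (geo_length c').
have m0 : 0 < m by rewrite lt_min !geo_length_gt0.
have lem s : 0 < s < m -> 0 < s < geo_length c /\ 0 < s < geo_length c'.
  by rewrite /m lt_min => /andP[-> /andP[-> ->]].
rewrite fin_real//; apply/andP; split.
- apply: (@lt_le_trans _ _ 0%E); first exact: ltNyr.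
  apply: le_ereal_inf_tmp => _ [V /F_small[e e0 eV] <-].
  have k0 : 0 < Num.min m e / 2 by rewrite divr_gt0// lt_min m0.
  have kl : Num.min m e / 2 < Num.min m e by rewrite ltr_pdivrMr// ltr_pMr ?ltr1n// lt_min m0.
  move: (Num.min m e / 2) k0 kl => k k0; rewrite lt_min => /andP[km ke].
  have [|k1 k2] := lem k; first by rewrite k0.
  have [h _ _] := caP k1 k2.
  apply: (@le_trans _ _ (ca c c' (k, k))%:E); first by rewrite lee_fin.
  by apply: ereal_sup_ubound; exists (k, k) => //; apply: eV; rewrite k0.
- apply: (@le_lt_trans _ _ (pi%:E)); last exact: ltry.
  apply: ge_ereal_inf; eexists; first by eexists; first exact: F_near m0.
  apply: ge_ereal_sup => _ [[s t] /= [/lem[s1 _] /lem[_ t2]] <-].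
  by rewrite lee_fin; have [] := caP s1 t2.
Qed.

Let angle_lt c c' (e : R) : 0 < e -> exists2 r : R, 0 < r &
  forall s t, 0 < s < r -> 0 < t < r -> ca c c' (s, t) < angle c c' + e.
Proof.
move=> e0.
have : (limf_esup (EFin \o ca c c') F < (angle c c' + e)%:E)%E.
  by rewrite EFinD fineK ?angle_fin// lteDl// angle_fin.
move=> /ereal_inf_lt[_ [V /F_small[r r0 rV] <-] Vlt].
exists r => // s t sr tr; rewrite -lte_fin; apply: le_lt_trans Vlt.
by apply: ereal_sup_ubound; exists (s, t) => //; exact: rV.
Qed.

Let angle_gt c c' (e r : R) : 0 < e -> 0 < r -> exists s t,
  [/\ 0 < s < r, 0 < t < r & angle c c' - e < ca c c' (s, t)].
Proof.
move=> e0 r0.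
have : ((angle c c' - e)%:E < limf_esup (EFin \o ca c c') F)%E.
  rewrite EFinB fineK ?angle_fin// lteBlDr// lteDl ?angle_fin//.
move=> /lt_le_trans /(_ (ereal_inf_lbound _)).
move=> /(_ (ereal_sup ((EFin \o ca c c') @` [set st | 0 < st.1 < r /\ 0 < st.2 < r]))).
case/(_ _)/ereal_sup_gt; first by eexists; first exact: F_near r0.
by move=> _ [[s t] /= [sr tr] <-]; rewrite lte_fin => h; exists s, t.
Qed.

Let angle_le c c' (a : R) :
  (exists2 r : R, 0 < r & forall s t, 0 < s < r -> 0 < t < r -> ca c c' (s, t) <= a) ->
  angle c c' <= a.
Proof.
move=> [r r0 H]; apply/ler_addgt0Pl => e e0.
have [s [t [sr tr h]]] := angle_gt c c' e0 r0.
have := H _ _ sr tr; lra.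
Qed.

Let anglexx c : angle c c = 0.
Proof.
have l0 := geo_length_gt0 c.
apply/eqP; rewrite eq_le; apply/andP; split.
  apply: angle_le; exists (geo_length c) => // s t sl tl.
  rewrite /ca /comparison_angle /= (geo_dist sl) (geo_dist tl).
  case/andP: sl => s0 sl; case/andP: tl => t0 tl.
  have -> : mdist (c s) (c t) = `|s - t|.
    by rewrite (geo_isometric (g := c)) //= in_itv/= !ltW.
  rewrite real_normK ?num_real// (_ : _ / _ = 1) ?acos1//.
  by field; rewrite !gt_eqF.
rewrite leNgt; apply/negP => alt0.
have [|r r0 H] := @angle_lt c c (- angle c c); first by lra.
pose k := Num.min r (geo_length c) / 2.
have k0 : 0 < k by rewrite divr_gt0// lt_min r0.
have : k < Num.min r (geo_length c).
  by rewrite ltr_pdivrMr// ltr_pMr ?ltr1n// lt_min r0.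
rewrite lt_min => /andP[kr kl].
have kr' : 0 < k < r by rewrite k0.
have kl' : 0 < k < geo_length c by rewrite k0.
have := H _ _ kr' kr'; have [h _ _] := caP kl' kl'; lra.
Qed.

Let angle_sym c c' : angle c c' = angle c' c.
Proof.
suff H c1 c2 : angle c1 c2 <= angle c2 c1 by apply/eqP; rewrite eq_le !H.
apply/ler_addgt0Pr => e e0; apply: angle_le.
have [r r0 h] := angle_lt c2 c1 e0; exists r => // s t sr tr.
by rewrite caC ltW// h.
Qed.

Let planar (a b al be : R) : 0 < a -> 0 < b -> 0 < al -> 0 < be ->
  al + be < pi ->
  exists t l : R, [/\ 0 < t, (t <= Num.max a b), 0 < l < 1,
   a ^+ 2 + t ^+ 2 - 2 * t * a * cos al =
     (1 - l) ^+ 2 * (a ^+ 2 + b ^+ 2 - 2 * a * b * cos (al + be)) &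
   t ^+ 2 + b ^+ 2 - 2 * t * b * cos be =
     l ^+ 2 * (a ^+ 2 + b ^+ 2 - 2 * a * b * cos (al + be))].
Proof.
move=> a0 b0 al0 be0 abpi.
have sa : 0 < sin al by rewrite sin_gt0_pi// al0; lra.
have sb : 0 < sin be by rewrite sin_gt0_pi// be0; lra.
have sab : 0 < sin (al + be) by rewrite sin_gt0_pi// addr_gt0.
rewrite sinD in sab; rewrite cosD.
have := cos2Dsin2 al; have := cos2Dsin2 be.
have := cos_le1 al; have := cos_le1 be.
move: (cos al) (sin al) (cos be) (sin be) sa sb sab => ca' sa cb sb sa0 sb0 sab cb1 ca1 eb ea.
have D0 : 0 < a * sa + b * sb by rewrite addr_gt0 ?mulr_gt0.
set D := a * sa + b * sb in D0.
exists (a * b * (sa * cb + ca' * sb) / D), (b * sb / D).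
have D1 : D != 0 by rewrite gt_eqF.
split.
- by rewrite divr_gt0 ?mulr_gt0.
- have mx1 : a <= Num.max a b by rewrite le_max lexx.
  have mx2 : b <= Num.max a b by rewrite le_max lexx orbT.
  rewrite ler_pdivrMr// /D; move: (Num.max a b) mx1 mx2 => m am bm.
  have h1 : a * ca' <= m by rewrite (le_trans _ am)// ger_pMr.
  have h2 : b * cb <= m by rewrite (le_trans _ bm)// ger_pMr.
  have -> : a * b * (sa * cb + ca' * sb) = a * ca' * (b * sb) + b * cb * (a * sa) by ring.
  by rewrite mulrDr [leRHS]addrC lerD// ler_pM2r// mulr_gt0.
- rewrite divr_gt0 ?mulr_gt0//= ltr_pdivrMr// mul1r /D ltrDr mulr_gt0//.
- have x1 : a * ca' - a * b * (sa * cb + ca' * sb) / D =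
            (1 - b * sb / D) * (a * ca' - b * cb) by rewrite /D; field.
  have y1 : a * sa = (1 - b * sb / D) * D by rewrite /D; field.
  have -> : a ^+ 2 + b ^+ 2 - 2 * a * b * (ca' * cb - sa * sb) =
            (a * ca' - b * cb) ^+ 2 + D ^+ 2.
    transitivity (a ^+ 2 * (ca' ^+ 2 + sa ^+ 2) + b ^+ 2 * (cb ^+ 2 + sb ^+ 2)
      - 2 * a * b * (ca' * cb - sa * sb)); first by rewrite ea eb !mulr1.
    by rewrite /D; ring.
  rewrite [RHS]mulrDr -![in RHS]exprMn -x1 -y1.
  move: (_ / D) => t.
  transitivity (a ^+ 2 * (ca' ^+ 2 + sa ^+ 2) + t ^+ 2 - 2 * t * a * ca');
    by [rewrite ea mulr1|ring].
- have x1 : a * b * (sa * cb + ca' * sb) / D - b * cb =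
            (b * sb / D) * (a * ca' - b * cb) by rewrite /D; field.
  have y1 : b * sb = (b * sb / D) * D by field.
  have -> : a ^+ 2 + b ^+ 2 - 2 * a * b * (ca' * cb - sa * sb) =
            (a * ca' - b * cb) ^+ 2 + D ^+ 2.
    transitivity (a ^+ 2 * (ca' ^+ 2 + sa ^+ 2) + b ^+ 2 * (cb ^+ 2 + sb ^+ 2)
      - 2 * a * b * (ca' * cb - sa * sb)); first by rewrite ea eb !mulr1.
    by rewrite /D; ring.
  rewrite [RHS]mulrDr -![in RHS]exprMn -x1 -y1.
  move: (a * b * _ / D) => t.
  transitivity (t ^+ 2 + b ^+ 2 * (cb ^+ 2 + sb ^+ 2) - 2 * t * b * cb);
    by [rewrite eb mulr1|ring].
Qed.

Let angle_ge0 c c' : 0 <= angle c c'.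
Proof.
rewrite leNgt; apply/negP => alt0.
have [|r r0 H] := @angle_lt c c' (- angle c c'); first by lra.
pose m := Num.min r (Num.min (geo_length c) (geo_length c')).
have m0 : 0 < m by rewrite !lt_min r0 !geo_length_gt0.
have k0 : 0 < m / 2 by rewrite divr_gt0.
have : m / 2 < m by rewrite ltr_pdivrMr// ltr_pMr ?ltr1n.
rewrite {2}/m !lt_min => /and3P[kr kl kl'].
have kc : 0 < m / 2 < geo_length c by rewrite k0.
have kc' : 0 < m / 2 < geo_length c' by rewrite k0.
have [h _ _] := caP kc kc'.
have := H (m / 2) (m / 2); rewrite k0 kr => /(_ isT isT); lra.
Qed.

Let angle_triangle c2 c1 c3 : angle c1 c3 <= angle c1 c2 + angle c2 c3.
Proof.
rewrite leNgt; apply/negP => H.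
pose e := (angle c1 c3 - angle c1 c2 - angle c2 c3) / 4.
have e0 : 0 < e by rewrite /e; lra.
have [r1 r10 h1] := angle_lt c1 c2 e0.
have [r2 r20 h2] := angle_lt c2 c3 e0.
pose m := Num.min r1 (Num.min r2
  (Num.min (geo_length c1) (Num.min (geo_length c2) (geo_length c3)))).
have m0 : 0 < m by rewrite !lt_min r10 r20 !geo_length_gt0.
have mP s : 0 < s < m -> [/\ 0 < s < r1, 0 < s < r2, 0 < s < geo_length c1,
    0 < s < geo_length c2 & 0 < s < geo_length c3].
  by rewrite /m !lt_min => /andP[-> /and5P[-> -> -> -> ->]].
have [a [b [am bm h3]]] := angle_gt c1 c3 e0 m0.
have [ar1 _ al1 _ _] := mP _ am; have [_ br2 _ _ bl3] := mP _ bm.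
have [p0 ppi d13] := caP al1 bl3.
pose al := angle c1 c2 + e; pose be := angle c2 c3 + e.
have al0 : 0 < al by rewrite ltr_wpDl ?angle_ge0.
have be0 : 0 < be by rewrite ltr_wpDl ?angle_ge0.
have albe : al + be < ca c1 c3 (a, b) by move: h3; rewrite /al /be /e; lra.
case/andP: (am) => a0 am'; case/andP: (bm) => b0 bm'.
have [|t [l [t0 tm /andP[l0 l1] e1 e2]]] := planar a0 b0 al0 be0.
  exact: lt_le_trans albe ppi.
have tm' : 0 < t < m by rewrite t0 (le_lt_trans tm)// gt_max am'.
have [tr1 tr2 _ tl2 _] := mP _ tm'.
have [q0 qpi d12] := caP al1 tl2; have [q0' qpi' d23] := caP tl2 bl3.
have lt12 := h1 _ _ ar1 tr1; have lt23 := h2 _ _ tr2 br2.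
have al_pi : al <= pi by rewrite (le_trans _ (le_trans (ltW albe) ppi))// lerDl ltW.
have be_pi : be <= pi by rewrite (le_trans _ (le_trans (ltW albe) ppi))// lerDr ltW.
have albe0 : 0 <= al + be by rewrite addr_ge0// ltW.
have c12 : cos al < cos (ca c1 c2 (a, t)).
  by rewrite ltr_cos// in_itv/= ?q0 ?qpi ?al_pi ?ltW.
have c23 : cos be < cos (ca c2 c3 (t, b)).
  by rewrite ltr_cos// in_itv/= ?q0' ?qpi' ?be_pi ?ltW.
have c13 : cos (ca c1 c3 (a, b)) < cos (al + be).
  by rewrite ltr_cos// in_itv/= ?p0 ?ppi ?albe0//= ltW// (lt_le_trans albe).
set K := a ^+ 2 + b ^+ 2 - 2 * a * b * cos (al + be) in e1 e2.
have {}d13 : K < mdist (c1 a) (c3 b) ^+ 2.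
  by rewrite d13 /K ltrD2l ltrN2 ltr_pM2l// !mulr_gt0.
have {}d12 : mdist (c1 a) (c2 t) ^+ 2 < (1 - l) ^+ 2 * K.
  rewrite -e1 d12 ltrD2l ltrN2 (_ : 2 * a * t = 2 * t * a); last by ring.
  by rewrite ltr_pM2l// !mulr_gt0.
have {}d23 : mdist (c2 t) (c3 b) ^+ 2 < l ^+ 2 * K.
  by rewrite -e2 d23 ltrD2l ltrN2 ltr_pM2l// !mulr_gt0.
have K0 : 0 <= K.
  rewrite leNgt; apply/negP => K0.
  have : l ^+ 2 * K <= 0 by rewrite mulr_ge0_le0 ?sqr_ge0// ltW.
  by have := sqr_ge0 (mdist (c2 t) (c3 b)); lra.
have L0 := sqrtr_ge0 K; have LK := sqr_sqrtr K0.
have D13 : Num.sqrt K < mdist (c1 a) (c3 b).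
  by rewrite -(@ltr_pXn2r _ 2)// ?nnegrE ?mdist_ge0// LK.
have D12 : mdist (c1 a) (c2 t) < (1 - l) * Num.sqrt K.
  rewrite -(@ltr_pXn2r _ 2)// ?nnegrE ?mdist_ge0// ?exprMn ?LK//.
  by rewrite mulr_ge0// subr_ge0 ltW.
have D23 : mdist (c2 t) (c3 b) < l * Num.sqrt K.
  rewrite -(@ltr_pXn2r _ 2)// ?nnegrE ?mdist_ge0// ?exprMn ?LK//.
  by rewrite mulr_ge0// ltW.
have := metric_triangle (c1 a) (c2 t) (c3 b); lra.
Qed.

Definition angle_pseudo_distance : pseudo_distance (geodesic_from p) :=
  @PseudoDistance R (geodesic_from p) (fun c c' => angle c c')
    anglexx angle_sym angle_triangle.

End angle_pseudo_distance.

(* Non-constant minimizing geodesics from p modulo angle 0. *)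
Definition directions_pre (p : X) : metricType R :=
  metric_quotient (angle_pseudo_distance p).

Definition space_of_directions (p : X) : metricType R :=
  completion (directions_pre p).

End directions.

Section isometries.
Context {R : realType} (X : metricType R).

Record self_isometry := SelfIsometry {
  iso_fun :> X -> X ;
  iso_dist : forall x y, mdist (iso_fun x) (iso_fun y) = mdist x y ;
  iso_surj : set_surj setT setT iso_fun }.

Definition elliptic (f : self_isometry) : Prop := exists x, f x = x.

Definition hyperbolic (f : self_isometry) : Prop :=
  exists (c : R -> X) (tau : R),
    [/\ is_line c, tau != 0 & forall t, f (c t) = c (t + tau)].

Definition parabolic (f : self_isometry) : Prop := ~ elliptic f /\ ~ hyperbolic f.

End isometries.

Section ideal_boundary.
Context {R : realType} (X : metricType R).

(* The values of a ray on negative numbers are irrelevant. *)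
Record ray := Ray {
  ray_fun :> R -> X ;
  ray_isometric : isometric_on `[0, +oo[ ray_fun }.

HB.instance Definition _ := gen_eqMixin ray.
HB.instance Definition _ := gen_choiceMixin ray.

Definition asymptotic (c c' : ray) : Prop :=
  exists K : R, forall t, 0 <= t -> mdist (c t) (c' t) <= K.

Definition asymptoticb : rel ray := fun c c' => `[< asymptotic c c' >].

Lemma asymptoticb_equiv : equiv_class_of asymptoticb.
Proof.
have sym c c' : asymptotic c c' -> asymptotic c' c.
  by move=> [K cK]; exists K => t t0; rewrite metric_sym cK.
split.
- by move=> c; apply/asboolP; exists 0 => t _; rewrite mdistxx.
- by move=> c c'; apply/asboolP/asboolP; exact: sym.
- move=> c2 c1 c3 /asboolP[K cK] /asboolP[L cL]; apply/asboolP.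
  exists (K + L) => t t0.
  by rewrite (le_trans (metric_triangle _ (c2 t) _))// lerD ?cK ?cL.
Qed.

Canonical asymptoticb_equiv_rel := EquivRelPack asymptoticb_equiv.

Definition ideal_boundary := {eq_quot asymptoticb_equiv_rel}.

HB.instance Definition _ := Choice.on ideal_boundary.
HB.instance Definition _ := EqQuotient.on ideal_boundary.

Definition endpoint (c : ray) : ideal_boundary := \pi_ideal_boundary c.

Lemma endpoint_eq (c c' : ray) : endpoint c = endpoint c' <-> asymptotic c c'.
Proof.
split=> [/eqP|cc'].
  by rewrite /endpoint piE => /asboolP.
by apply/eqP; rewrite /endpoint piE; apply/asboolP.
Qed.

Let iso_ray_isometric (f : self_isometry X) (c : ray) :
  isometric_on `[0, +oo[ (f \o c).
Proof. by move=> s t s0 t0; rewrite /= iso_dist; exact: ray_isometric. Qed.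

Definition iso_ray (f : self_isometry X) (c : ray) : ray :=
  Ray (@iso_ray_isometric f c).

Definition iso_boundary (f : self_isometry X) (x : ideal_boundary) :
  ideal_boundary := endpoint (iso_ray f (repr x)).

Lemma iso_boundaryE (f : self_isometry X) (c : ray) :
  iso_boundary f (endpoint c) = endpoint (iso_ray f c).
Proof.
apply/endpoint_eq.
have /endpoint_eq[K cK] : endpoint (repr (endpoint c)) = endpoint c by exact: reprK.
by exists K => t t0; rewrite /= iso_dist cK.
Qed.

Definition fixed_at_infinity (f : self_isometry X) : set ideal_boundary :=
  [set x | iso_boundary f x = x].

(* The supremum over p of the angle at p between the rays from p to x and from
   p to y; these rays exist and are unique when X is complete and CAT(0). *)
Definition boundary_angle (x y : ideal_boundary) : R :=
  sup [set a | exists (p : X) (c c' : ray),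
    [/\ c 0 = p, c' 0 = p, endpoint c = x, endpoint c' = y & a = angle c c']].

(* Curves are parametrized by [0, 1], continuity being with respect to
   boundary_angle (not to the cone topology). *)
Definition is_boundary_curve (x y : ideal_boundary) (g : R -> ideal_boundary) :
    Prop :=
  [/\ g 0 = x, g 1 = y & forall t, t \in `[0, 1] ->
    boundary_angle (g t) (g s) @[s --> within `[0, 1] (nbhs t)] --> 0].

Definition boundary_length (g : R -> ideal_boundary) : \bar R :=
  ereal_sup [set (\sum_(0 <= i < size s)
    boundary_angle (g (nth 1 (0 :: s) i)) (g (nth 1 (0 :: s) i.+1)))%:E |
    s in itv_partition 0 1].

Definition tits_distance (x y : ideal_boundary) : \bar R :=
  ereal_inf [set boundary_length g | g in is_boundary_curve x y].

Definition visible : Prop :=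
  forall x y : ideal_boundary, x != y -> tits_distance x y = +oo%E.

End ideal_boundary.

(* Main.v *)
Require Import Defs.
From mathcomp Require Import all_boot all_order all_algebra.
From mathcomp Require Import all_classical all_reals all_analysis.
From mathcomp Require Import ring lra zify.

Set Implicit Arguments.
Unset Strict Implicit.
Unset Printing Implicit Defensive.

Import Order.TTheory GRing.Theory Num.Theory.
Import numFieldNormedType.Exports.

Local Open Scope classical_set_scope.
Local Open Scope ring_scope.

(** A semisimple isometry is one whose displacement d(x, f x) attains its
    minimum, even only on a subset S that is invariant and contains the midpoint
    of any two of its points: at a minimum p the midpoint inequality of CAT(0)
    geometry, applied in S to the powers f^(2^k), gives d(p, f^n p) = n d(p, f p),
    so that p is fixed or the orbit of p is evenly spaced on an axis
    ([minimal_displacement_semisimple]). Both halves of the theorem are obtained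
    by confronting a parabolic isometry with this fact.

    Existence. Since X is proper and displacement has no minimum, the points of
    displacement at most d(o, f o) escape to infinity. By convexity of the
    displacement, a limit ray of geodesics from o to such points is moved by f a
    bounded amount: its endpoint is fixed ([parabolic_fixes_ray]).

    Uniqueness. Infinite Tits distances are used through two facts. If rays from
    o satisfy d(c t, c' t) <= k t with k < 2, the segments from c n to c' n stay at
    distance at least (1 - k / 2) n from o, and the limits of the directions of
    their points form a path from the one endpoint to the other that is Lipschitz
    for the boundary angle, hence of finite Tits length
    ([tits_distance_lt_pinfty]). In a visible space such rays therefore have the
    same endpoint. Consequently ([visibility]) geodesics with ends near two rays
    with different endpoints all meet a fixed ball: the feet of the perpendiculars
    from o would otherwise escape in a direction at angle at most pi / 2 from both
    rays, whose endpoint would be that of both.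

    Let now f fix two endpoints. By visibility there is a line joining them, and
    every such line meets a fixed ball. The union S of these lines is invariant,
    and midpoint closed because parallel lines bound a flat strip
    ([middle_line]). Displacement is constant along each line, being bounded and
    convex there. Hence it attains its minimum over S in a compact ball, and f is
    not parabolic ([two_fixed_endpoints_semisimple]).

    All limits of sequences of points and of geodesics are taken along one
    ultrafilter on nat, which gives the limits for all parameters at once. *)

(** * Comparison inequalities in CAT(0) spaces *)

Section Cat0.
Context {R : realType} {X : metricType R}.
Implicit Types (x y z p q : X) (l r s t : R).

(** The point p divides [x, y] in the ratio l. In a CAT(0) space these two
    equations determine p, and, unlike a parametrized geodesic, they are preserved
    by isometries and by exchanging x and y. *)
Definition between (l : R) (x y p : X) : Prop :=
  mdist x p = l * mdist x y /\ mdist p y = (1 - l) * mdist x y.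

Lemma between_sym l x y p : between l x y p -> between (1 - l) y x p.
Proof.
by move=> [h1 h2]; split; rewrite metric_sym (metric_sym y) ?h1 ?h2// opprB addrCA subrr addr0.
Qed.

Lemma le_of_sqr (a b : R) : 0 <= b -> a ^+ 2 <= b ^+ 2 -> a <= b.
Proof.
move=> b0 ab; rewrite leNgt; apply/negP => ba.
have : b ^+ 2 < a ^+ 2 by rewrite ltr_pXn2r// nnegrE// (le_trans b0)// ltW.
by rewrite ltNge ab.
Qed.

Lemma euclid2E (u v : R * R) (a : R) : 0 <= a ->
  (u.1 - v.1) ^+ 2 + (u.2 - v.2) ^+ 2 = a ^+ 2 -> euclid2 u v = a.
Proof. by move=> a0 h; rewrite /euclid2 h sqrtr_sqr ger0_norm. Qed.

Lemma iso_segment L (g : R -> X) s t : isometric_on `[0, L] g ->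
  0 <= s <= L -> 0 <= t <= L -> mdist (g s) (g t) = `|s - t|.
Proof. by move=> gi sL tL; rewrite gi//= in_itv. Qed.

Lemma geodesic_dist x y L (g : R -> X) s t : is_geodesic x y L g ->
  0 <= s -> s <= t -> t <= L -> mdist (g s) (g t) = t - s.
Proof.
move=> [L0 gi g0 gL] s0 st tL.
rewrite (iso_segment gi) ?s0 ?tL ?(le_trans s0 st) ?(le_trans st tL)//.
by rewrite distrC ger0_norm// subr_ge0.
Qed.

Lemma geodesic_length x y L (g : R -> X) : is_geodesic x y L g -> mdist x y = L.
Proof.
move=> gg; have [L0 _ g0 gL] := gg.
by rewrite -g0 -gL (geodesic_dist gg) ?lexx// subr0.
Qed.

Lemma geodesic_between x y L (g : R -> X) t :
  is_geodesic x y L g -> 0 < L -> 0 <= t <= L -> between (t / L) x y (g t).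
Proof.
move=> gg Lp /andP[t0 tL]; have [L0 gi g0 gL] := gg.
rewrite /between (geodesic_length gg) -g0 -gL.
by rewrite !(geodesic_dist gg) ?lexx//; split; field; rewrite gt_eqF.
Qed.

Hypothesis cat : CAT0 X.

Lemma exists_geodesic x y : exists g, is_geodesic x y (mdist x y) g.
Proof.
have [l [c h]] := cat.1 x y; exists c.
case: (h) => l0 ci c0 cl.
by rewrite (geodesic_length h).
Qed.

Lemma exists_between l x y : 0 <= l <= 1 -> exists p, between l x y p.
Proof.
move=> /andP[l0 l1].
have [g gg] := exists_geodesic x y.
have := mdist_ge0 x y; rewrite le_eqVlt => /predU1P[d0|dp].
  by exists x; rewrite /between mdistxx -d0 !mulr0.
exists (g (l * mdist x y)).
have := geodesic_between (t := l * mdist x y) gg dp.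
rewrite mulfK ?gt_eqF//; apply; rewrite mulr_ge0 ?(ltW dp)//=.
by rewrite ger_pMl.
Qed.

(** The comparison triangle has its vertex x at the origin and y on the first
    axis; the bound is the squared length of the Euclidean segment. *)
Lemma stewart_geodesic x y z p : on_geodesic x y p ->
  forall l, 0 <= l <= 1 -> between l x y p ->
  mdist p z ^+ 2 <= (1 - l) * mdist x z ^+ 2 + l * mdist y z ^+ 2
                    - l * (1 - l) * mdist x y ^+ 2.
Proof.
move=> xyp l /andP[l0 l1] [xp py].
have [_ cmp] := cat.
have onz : on_geodesic x z z.
  have [g gg] := exists_geodesic x z; exists (mdist x z), g, (mdist x z); split=> //.
    by rewrite in_itv/= lexx mdist_ge0.
  by case: gg.
have := cmp x y z p z xyp onz; clear cmp.
have h1 := metric_triangle x y z.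
have h2 := metric_triangle y x z.
have h3 := metric_triangle x z y.
rewrite (metric_sym y x) (metric_sym z y) in h1 h2 h3.
rewrite xp py; move: h1 h2 h3.
set a := mdist x y; set b := mdist x z; set c := mdist y z.
have a0 : 0 <= a by exact: mdist_ge0.
have b0 : 0 <= b by exact: mdist_ge0.
have c0 : 0 <= c by exact: mdist_ge0.
rewrite mdistxx => h1 h2 h3.
move: (a0); rewrite le_eqVlt => /predU1P[ea|ap].
  rewrite -ea !mulr0 ?expr0n/= ?mulr0 ?subr0 in xp *.
  have ->: p = x by apply/esym/mdist_positivity; rewrite xp -/a -ea mulr0.
  have -> : c = b by lra.
  by move=> _; rewrite -/b; lra.
(* (u, v) is the vertex z of the comparison triangle, by the law of cosines. *)
pose u := (b ^+ 2 + a ^+ 2 - c ^+ 2) / (2 * a).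
have ua : 2 * a * u = b ^+ 2 + a ^+ 2 - c ^+ 2 by rewrite /u; field; rewrite gt_eqF.
have ub : 0 <= b ^+ 2 - u ^+ 2.
  have h : (2 * a * u) ^+ 2 <= (2 * a * b) ^+ 2.
    rewrite ua -subr_ge0.
    have -> : (2 * a * b) ^+ 2 - (b ^+ 2 + a ^+ 2 - c ^+ 2) ^+ 2 =
      (a + b + c) * (a + b - c) * (c - (b - a)) * (c + (b - a)) by ring.
    by rewrite !mulr_ge0//; lra.
  rewrite -subr_ge0 in h.
  have {}h : 0 <= (2 * a) ^+ 2 * (b ^+ 2 - u ^+ 2) by move: h; rewrite !exprMn; lra.
  by rewrite pmulr_rge0 ?exprn_gt0 ?mulr_gt0 in h.
pose v := Num.sqrt (b ^+ 2 - u ^+ 2).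
have v2 : v ^+ 2 = b ^+ 2 - u ^+ 2 by rewrite sqr_sqrtr.
move=> /(_ (0, 0) (a, 0) (u, v) (l * a, 0) (u, v)).
have la0 : 0 <= l * a by rewrite mulr_ge0.
have l1a0 : 0 <= (1 - l) * a by rewrite mulr_ge0// subr_ge0.
have E0 : euclid2 (0, 0) (a, 0) = a by apply: euclid2E => //=; ring.
have E1 : euclid2 (a, 0) (u, v) = c by apply: euclid2E => //=; rewrite sub0r sqrrN v2; lra.
have E2 : euclid2 (0, 0) (u, v) = b by apply: euclid2E => //=; rewrite !sub0r !sqrrN v2; lra.
have E3 : euclid2 (0, 0) (l * a, 0) = l * a by apply: euclid2E => //=; ring.
have E4 : euclid2 (l * a, 0) (a, 0) = (1 - l) * a by apply: euclid2E => //=; ring.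
have E5 : euclid2 (u, v) (u, v) = 0 by apply: euclid2E => //=; rewrite !subrr; ring.
move=> /(_ E0 E1 E2 E3 E4 E2 E5) h.
have {}h : mdist p z ^+ 2 <= euclid2 (l * a, 0) (u, v) ^+ 2.
  by rewrite ler_pXn2r// nnegrE ?mdist_ge0// sqrtr_ge0.
apply: (le_trans h).
rewrite /euclid2 sqr_sqrtr ?addr_ge0 ?sqr_ge0//= sub0r sqrrN v2.
have -> : (l * a - u) ^+ 2 + (b ^+ 2 - u ^+ 2) =
  l ^+ 2 * a ^+ 2 - l * (2 * a * u) + b ^+ 2 by ring.
by rewrite ua; lra.
Qed.

(** A point that satisfies the two equations of [between] is on the geodesic:
    the inequality for the geodesic point with the same ratio, taken at z = p,
    shows that the two points coincide. *)
Lemma stewart l x y z p : 0 <= l <= 1 -> between l x y p ->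
  mdist p z ^+ 2 <= (1 - l) * mdist x z ^+ 2 + l * mdist y z ^+ 2
                    - l * (1 - l) * mdist x y ^+ 2.
Proof.
move=> l01 xyp; apply: stewart_geodesic => //.
have [g gg] := exists_geodesic x y.
have := mdist_ge0 x y; rewrite le_eqVlt => /predU1P[d0|dp].
  exists (mdist x y), g, 0; split=> //; first by rewrite in_itv/= lexx mdist_ge0.
  case: gg => _ _ -> _; apply/esym/mdist_positivity.
  by case: xyp => -> _; rewrite -d0 mulr0.
have tl : 0 <= l * mdist x y <= mdist x y.
  by case/andP: l01 => l0 l1; rewrite mulr_ge0 ?(ltW dp)//= ger_pMl.
exists (mdist x y), g, (l * mdist x y); split=> //.
have bq : between l x y (g (l * mdist x y)).
  by have := geodesic_between gg dp tl; rewrite mulfK ?gt_eqF.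
have gq : on_geodesic x y (g (l * mdist x y)).
  by exists (mdist x y), g, (l * mdist x y); split.
apply/esym/mdist_positivity/eqP; rewrite -sqrf_eq0 eq_le sqr_ge0 andbT.
have := stewart_geodesic p gq l01 bq.
case: xyp => h1 h2; rewrite h1 (metric_sym y p) h2 => /le_trans; apply.
by rewrite !exprMn; lra.
Qed.

(** The right-hand side is the squared Euclidean distance of the comparison
    points, expressed by the inner product of the sides at z; two applications of
    [stewart] give it. *)
Lemma comparison l m z x y p q : 0 <= l <= 1 -> 0 <= m <= 1 ->
  between l z x p -> between m z y q ->
  mdist p q ^+ 2 <= l ^+ 2 * mdist z x ^+ 2 + m ^+ 2 * mdist z y ^+ 2
   - l * m * (mdist z x ^+ 2 + mdist z y ^+ 2 - mdist x y ^+ 2).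
Proof.
move=> /andP[l0 l1] /andP[m0 m1] zp zq.
have h1 := @stewart m z y p q; rewrite m0 m1 in h1; have {}h1 := h1 isT zq.
have h2 := @stewart l z x y p; rewrite l0 l1 in h2; have {}h2 := h2 isT zp.
rewrite metric_sym; apply: (le_trans h1); case: zp => -> _; rewrite (metric_sym y).
have := ler_wpM2l m0 h2.
by rewrite exprMn; lra.
Qed.

Lemma thales l z x y p q : 0 <= l <= 1 -> between l z x p -> between l z y q ->
  mdist p q <= l * mdist x y.
Proof.
move=> l01 zp zq; have l0 : 0 <= l by case/andP: l01.
apply: le_of_sqr; first by rewrite mulr_ge0 ?mdist_ge0.
apply: (le_trans (comparison l01 l01 zp zq)).
by rewrite exprMn; lra.
Qed.

(** The diagonal [x, y'] splits the quadrilateral into two triangles, to each of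
    which the preceding inequality applies. *)
Lemma dist_convex l x x' y y' p p' : 0 <= l <= 1 -> between l x y p ->
  between l x' y' p' ->
  mdist p p' <= (1 - l) * mdist x x' + l * mdist y y'.
Proof.
move=> l01 xp xp'.
have l01' : 0 <= 1 - l <= 1 by case/andP: l01 => l0 l1; rewrite subr_ge0 l1 gerBl.
have [w xw] := exists_between x y' l01.
have h1 := thales l01 xp xw.
have h2 := thales l01' (between_sym xw) (between_sym xp').
by apply: (le_trans (metric_triangle p w p')); lra.
Qed.

(** The parallelogram law with an inequality: compare y and w with the midpoint
    of the diagonal [x, z]. *)
Lemma quadrilateral x y z w :
  mdist x z ^+ 2 + mdist y w ^+ 2 <=
  mdist x y ^+ 2 + mdist y z ^+ 2 + mdist z w ^+ 2 + mdist w x ^+ 2.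
Proof.
have l01 : 0 <= (2^-1 : R) <= 1 by lra.
have [m xm] := exists_between x z l01.
have h1 := stewart y l01 xm; have h2 := stewart w l01 xm.
have h3 := metric_triangle y m w; rewrite (metric_sym y m) in h3.
have h4 : mdist y w ^+ 2 <= (mdist m y + mdist m w) ^+ 2.
  by rewrite ler_pXn2r// nnegrE ?addr_ge0 ?mdist_ge0.
have h5 := sqr_ge0 (mdist m y - mdist m w).
rewrite (metric_sym y z) (metric_sym w x); nra.
Qed.

(** Geodesics with nearby ends stay nearby when both are parametrized by arc
    length; the factor 2 pays for the difference of the lengths. *)
Lemma fellow_travel x x' y y' L L' (g g' : R -> X) r :
  is_geodesic x y L g -> is_geodesic x' y' L' g' -> 0 < L ->
  0 <= r <= L -> r <= L' ->
  mdist (g r) (g' r) <= mdist x x' + 2 * (r / L) * mdist y y'.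
Proof.
move=> gg gg' Lp /andP[r0 rL] rL'.
have [L0' gi' g0' gl'] := gg'.
pose l := r / L; have rE : r = l * L by rewrite /l divfK ?gt_eqF.
have l0 : 0 <= l by rewrite divr_ge0// ltW.
have l1 : l <= 1 by rewrite ler_pdivrMr// mul1r.
have l01 : 0 <= l <= 1 by rewrite l0.
have lL' : 0 <= l * L' <= L' by rewrite mulr_ge0//= ler_piMl.
have b1 : between l x y (g r) by apply: geodesic_between => //; rewrite r0.
have b2 : between l x' y' (g' (l * L')).
  move: L0'; rewrite le_eqVlt => /predU1P[e0|Lp'].
    have h0 : mdist x' y' = 0 by rewrite -g0' -gl' -e0 mdistxx.
    rewrite /between -e0 mulr0 g0' h0 !mulr0 mdistxx; split=> //.
  by have := geodesic_between gg' Lp' lL'; rewrite mulfK ?gt_eqF.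
have h := dist_convex l01 b1 b2.
have h' : mdist (g' (l * L')) (g' r) = l * `|L' - L|.
  rewrite (iso_segment gi') ?r0 ?rL' ?lL'//.
  have -> : l * L' - r = l * (L' - L) by rewrite mulrBr -rE.
  by rewrite normrM (ger0_norm l0).
have dL := geodesic_length gg; have dL' := geodesic_length gg'.
have hL : `|L' - L| <= mdist x x' + mdist y y'.
  rewrite -dL -dL' ler_norml.
  have h1 := metric_triangle x x' y; have h2 := metric_triangle x' y' y.
  have h3 := metric_triangle x' x y'; have h4 := metric_triangle x y y'.
  rewrite (metric_sym x' x) (metric_sym y' y) in h2 h3; apply/andP; split; lra.
have := metric_triangle (g r) (g' (l * L')) (g' r); rewrite h'.
by have := ler_wpM2l l0 hL; rewrite -/l; lra.
Qed.

End Cat0.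

(** * Limits of geodesics along an ultrafilter *)

Lemma exists_ultrafilter : exists U : set_system nat, UltraFilter U /\ \oo `<=` U.
Proof. exact: ultraFilterLemma. Qed.

Section Ultralimits.
Context {R : realType} {X : metricType R}.
Implicit Types (x y o : X) (u v : nat -> X).
Hypothesis proper : proper_space X.
Variables (U : set_system nat) (UU : UltraFilter U) (oU : \oo `<=` U).

(** Convergence along U, phrased with the distance so that inequalities pass to
    the limit without reference to the topology of X. *)
Definition tends u x : Prop := forall e : R, 0 < e -> U [set n | mdist (u n) x < e].

Lemma ultra_ge (r : R) : U [set n | r <= n%:R].
Proof. by apply: oU; exact: nbhs_infty_ger. Qed.

Lemma ultra_all (P : set nat) : (forall n, P n) -> U P.
Proof. by move=> h; apply: filterS (filterT : U setT). Qed.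

(** The only use of properness: a bounded sequence has a cluster point, which
    for an ultrafilter is a limit. *)
Lemma tends_exists u o (K : R) : U [set n | mdist o (u n) <= K] ->
  exists x, tends u x.
Proof.
move=> uK; pose A := [set x : X | mdist o x <= K].
have cA : compact A.
  apply: (@proper A o (K + 1)); last first.
    by move=> x /=; rewrite ballEmdist/= /A/= => h; rewrite (le_lt_trans h)// ltrDl.
  move=> x clx; rewrite /A/=; apply/ler_addgt0Pr => e e0.
  have [y [/= Ay]] := clx _ (nbhsx_ballx x e e0).
  rewrite ballEmdist/= metric_sym => xy.
  by rewrite (le_trans (metric_triangle o y x))// lerD// ltW.
have [x [_ clux]] := cA (u @ U) _ uK.
exists x => e e0.
have [//|far] := in_ultra_setVsetC [set n | mdist (u n) x < e] UU.
have [|y [yfar /yfar]//] := clux (~` ball x e) (ball x e) _ (nbhsx_ballx x e e0).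
rewrite /nbhs/=; apply: filterS far => n /= h1; rewrite ballEmdist/= metric_sym => h2.
exact: h1.
Qed.

Lemma tends_cst x : tends (fun=> x) x.
Proof. by move=> e e0; apply: ultra_all => n /=; rewrite mdistxx. Qed.

Lemma tends_iso (f : self_isometry X) u x : tends u x -> tends (f \o u) (f x).
Proof. by move=> ux e e0; apply: filterS (ux e e0) => n /=; rewrite iso_dist. Qed.

Lemma tends_le u v x y (K : R) : tends u x -> tends v y ->
  (forall e : R, 0 < e -> U [set n | mdist (u n) (v n) <= K + e]) -> mdist x y <= K.
Proof.
move=> ux vy h; apply/ler_addgt0Pr => e e0.
have e30 : 0 < e / 3 by rewrite divr_gt0.
have [n [[/= h1 h2] h3]] := filter_ex (filterI (filterI (ux _ e30) (vy _ e30)) (h _ e30)).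
have := metric_triangle x (u n) y; have := metric_triangle (u n) (v n) y.
rewrite (metric_sym x (u n)); lra.
Qed.

Lemma tends_ge u v x y (K : R) : tends u x -> tends v y ->
  U [set n | K <= mdist (u n) (v n)] -> K <= mdist x y.
Proof.
move=> ux vy h; apply/ler_addgt0Pr => e e0.
have e30 : 0 < e / 3 by rewrite divr_gt0.
have [n [[/= h1 h2] h3]] := filter_ex (filterI (filterI (ux _ e30) (vy _ e30)) h).
have := metric_triangle (u n) x (v n); have := metric_triangle x y (v n).
rewrite (metric_sym y (v n)); lra.
Qed.

(** The curves need to be isometric at a given pair of parameters only
    eventually: their domains of definition may grow with n. *)
Lemma limit_curve (A : set R) (g : nat -> R -> X) o :
  (forall s, A s -> exists K : R, U [set n | mdist o (g n s) <= K]) ->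
  (forall s t, A s -> A t -> U [set n | mdist (g n s) (g n t) = `|s - t|]) ->
  exists c : R -> X, isometric_on A c /\ forall s, A s -> tends (fun n => g n s) (c s).
Proof.
move=> bd iso.
have /choice[c cP] : forall s, exists x, A s -> tends (fun n => g n s) x.
  move=> s; have [As|nAs] := pselect (A s); last by exists o.
  by have [K /tends_exists[x gx]] := bd s As; exists x.
exists c; split=> // s t As At; apply/eqP; rewrite eq_le; apply/andP; split.
  apply: (tends_le (cP s As) (cP t At)) => e e0.
  by apply: filterS (iso s t As At) => n /= ->; rewrite lerDl ltW.
apply: (tends_ge (cP s As) (cP t At)).
by apply: filterS (iso s t As At) => n /= ->.
Qed.

Lemma limit_ray o (q : nat -> X) (L : nat -> R) (g : nat -> R -> X) :
  (forall n, is_geodesic o (q n) (L n) (g n)) ->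
  (forall r, U [set n | r <= L n]) ->
  exists c : ray X, c 0 = o /\ forall r, 0 <= r -> tends (fun n => g n r) (c r).
Proof.
move=> gg Loo.
have [||c [ci cg]] := @limit_curve `[0, +oo[ g o.
- move=> s /=; rewrite in_itv/= andbT => s0; exists s.
  apply: filterS (Loo s) => n /= sL; have [_ _ <- _] := gg n.
  by rewrite (geodesic_dist (gg n)) ?lexx// subr0.
- move=> s t /=; rewrite !in_itv/= !andbT => s0 t0.
  apply: filterS (filterI (Loo s) (Loo t)) => n /= [sL tL].
  by have [_ gi _ _] := gg n; rewrite (iso_segment gi) ?s0 ?t0.
have cg' r : 0 <= r -> tends (fun n => g n r) (c r).
  by move=> r0; apply: cg; rewrite /= in_itv/= r0.
exists (Ray ci); split=> //=; apply: mdist_positivity.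
apply/eqP; rewrite eq_le mdist_ge0 andbT.
apply: (tends_le (cg' 0 (lexx _)) (tends_cst o)) => e e0.
by apply: ultra_all => n /=; have [_ _ -> _] := gg n; rewrite mdistxx add0r ltW.
Qed.

End Ultralimits.

(** * Angles seen from the ideal boundary *)

Section Trigo.
Context {R : realType}.

Lemma cos_quarter_sqr : cos (pi / 4 : R) ^+ 2 = 1 / 2.
Proof.
have := cos_mulr2n (pi / 4 : R).
have -> : (pi / 4 : R) *+ 2 = pi / 2 by rewrite mulr2n; field.
by rewrite cos_pihalf mulr2n; lra.
Qed.

(** The mean value theorem on [0, x / 2], where cos is at least cos (pi / 4),
    and the duplication formula; the constant 1 / 2 is cos (pi / 4) ^+ 2. *)
Lemma sin_lower_bound (x : R) : 0 <= x <= pi / 2 -> x / 2 <= sin x.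
Proof.
move=> /andP[]; rewrite le_eqVlt => /predU1P[<-|x0] xpi.
  by rewrite mul0r sin0.
have pi0 := @pi_gt0 R.
pose k := cos (pi / 4 : R).
have cosk (y : R) : 0 <= y <= pi / 4 -> k <= cos y.
  move=> /andP[y0 y1].
  move: y1; rewrite le_eqVlt => /predU1P[->//|y1].
  by rewrite ltW// ltr_cos// in_itv/=; apply/andP; split; lra.
have k0 : 0 <= k.
  by rewrite /k; apply: cos_ge0_pihalf; apply/andP; split; lra.
have k2 : k ^+ 2 = 1 / 2 by exact: cos_quarter_sqr.
have [||c] := @MVT R sin cos 0 (x / 2); first by lra.
  by apply: continuous_subspaceT => z; exact: continuous_sin.
rewrite in_itv/= => /andP[c0 cx]; rewrite sin0 !subr0 => sx.
have h1 := cosk c; have h2 := cosk (x / 2).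
have {}h1 : k <= cos c by apply: h1; apply/andP; split; lra.
have {}h2 : k <= cos (x / 2) by apply: h2; apply/andP; split; lra.
have -> : sin x = 2 * (cos (x / 2) * sin (x / 2)).
  have := sin_mulr2n (x / 2); have -> : (x / 2) *+ 2 = x by rewrite mulr2n; field.
  by move=> ->; rewrite mulr2n; ring.
rewrite sx.
have h3 : k * k <= cos (x / 2) * cos c by rewrite ler_pM.
have := ler_wpM2r (ltW x0) h3.
by rewrite -expr2 k2; lra.
Qed.

(** 1 - D ^+ 2 / 2 is the cosine of the angle at the apex of an isosceles triangle
    with unit sides and base D. A bound linear in D is what makes paths that are
    Lipschitz in D rectifiable. *)
Lemma angle_le_chord (th D : R) : 0 <= th <= pi -> 0 <= D ->
  1 - D ^+ 2 / 2 <= cos th -> th <= 2 * D.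
Proof.
move=> /andP[th0 thpi] D0 h.
have := @sin_lower_bound (th / 2).
have -> : 0 <= th / 2 <= pi / 2 by apply/andP; split; lra.
move=> /(_ isT) hs.
have c2 : cos th = 1 - 2 * sin (th / 2) ^+ 2.
  have := cos_mulr2n (th / 2); have -> : (th / 2) *+ 2 = th by rewrite mulr2n; field.
  by move=> ->; rewrite mulr2n cos2sin2; ring.
apply: le_of_sqr; first by lra.
have : (th / 2 / 2) ^+ 2 <= sin (th / 2) ^+ 2.
  by rewrite ler_pXn2r// nnegrE; lra.
by rewrite c2 in h; lra.
Qed.

End Trigo.

Section BoundaryAngle.
Context {R : realType} {X : metricType R}.
Hypothesis cat : CAT0 X.
Implicit Types (c e : ray X).

Lemma ray_dist c s t : 0 <= s -> 0 <= t -> mdist (c s) (c t) = `|s - t|.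
Proof. by move=> s0 t0; apply: ray_isometric; rewrite /= in_itv/= ?s0 ?t0. Qed.

Lemma ray_geodesic c L : 0 <= L -> is_geodesic (c 0) (c L) L c.
Proof.
move=> L0; split=> // s t /=; rewrite !in_itv/= => /andP[s0 _] /andP[t0 _].
exact: ray_dist.
Qed.

Lemma angle_rays_ge0 c e : c 0 = e 0 -> 0 <= angle c e.
Proof.
move=> ce.
pose E : geodesic_from (c 0) :=
  GeodesicFrom ltr01 (esym ce) (let: And4 _ h _ _ := ray_geodesic e ler01 in h).
pose C : geodesic_from (c 0) :=
  GeodesicFrom ltr01 erefl (let: And4 _ h _ _ := ray_geodesic c ler01 in h).
exact: (pdist_ge0 (angle_pseudo_distance (c 0)) C E).
Qed.

(** The hypothesis is about points at equal distances from the common origin;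
    comparison with the pair of points at distance s + t handles unequal ones. *)
Lemma comparison_angle_le c e (D s t : R) : c 0 = e 0 -> 0 <= D ->
  (forall r, 0 <= r -> mdist (c r) (e r) <= D * r) -> 0 < s -> 0 < t ->
  comparison_angle (c 0) (c s) (e t) <= 2 * D.
Proof.
move=> ce D0 h s0 t0.
pose N := s + t; have N0 : 0 < N by rewrite addr_gt0.
have sN : 0 <= s <= N by rewrite ltW//= lerDl ltW.
have tN : 0 <= t <= N by rewrite ltW//= lerDr ltW.
have lN u : 0 <= u <= N -> 0 <= u / N <= 1.
  by move=> /andP[u0 uN]; rewrite divr_ge0 ?(ltW N0)//= ler_pdivrMr// mul1r.
have gc := ray_geodesic c (ltW N0); have ge := ray_geodesic e (ltW N0).
have bc := geodesic_between gc N0 sN.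
have be := geodesic_between ge N0 tN; rewrite -ce in be ge.
have := comparison cat (lN s sN) (lN t tN) bc be.
rewrite (geodesic_length gc) (geodesic_length ge) => h1.
have {}h1 : mdist (c s) (e t) ^+ 2 <= s ^+ 2 + t ^+ 2 - s * t * (2 - D ^+ 2).
  have h2 : mdist (c N) (e N) ^+ 2 <= (D * N) ^+ 2.
    by rewrite ler_pXn2r ?h ?nnegrE ?mdist_ge0 ?mulr_ge0 ?(ltW N0)// ltW.
  have h3 : s / N * (t / N) * mdist (c N) (e N) ^+ 2 <= s / N * (t / N) * (D * N) ^+ 2.
    by rewrite ler_wpM2l// mulr_ge0// divr_ge0// ltW.
  have e1 : s / N * (t / N) * (D * N) ^+ 2 = s * t * D ^+ 2.
    by field; rewrite gt_eqF.
  have e2 : (s / N) ^+ 2 * N ^+ 2 = s ^+ 2 by field; rewrite gt_eqF.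
  have e3 : (t / N) ^+ 2 * N ^+ 2 = t ^+ 2 by field; rewrite gt_eqF.
  have e4 : s / N * (t / N) * (N ^+ 2 + N ^+ 2) = 2 * s * t.
    by field; rewrite gt_eqF.
  move: h1; rewrite mulrBr e2 e3 e4; lra.
have ds : mdist (c 0) (c s) = s by rewrite ray_dist ?lexx ?ltW// sub0r normrN gtr0_norm.
have dt : mdist (c 0) (e t) = t.
  by rewrite ce ray_dist ?lexx ?ltW// sub0r normrN gtr0_norm.
rewrite /comparison_angle ds dt.
have st0 : 0 < 2 * s * t by rewrite !mulr_gt0.
have t1 := metric_triangle (c s) (c 0) (e t).
have t2 := metric_triangle (c 0) (c s) (e t).
have t3 := metric_triangle (c 0) (e t) (c s).
rewrite (metric_sym (c s) (c 0)) (metric_sym (e t) (c s)) ds dt in t1 t2 t3.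
set m := mdist (c s) (e t) in h1 t1 t2 t3 *.
have m0 : 0 <= m by exact: mdist_ge0.
have B : -1 <= (s ^+ 2 + t ^+ 2 - m ^+ 2) / (2 * s * t) <= 1.
  by rewrite ler_pdivlMr// ler_pdivrMr//; apply/andP; split; nra.
apply: angle_le_chord => //; first by rewrite acos_ge0 ?acos_lepi.
rewrite acosK ?in_itv//= ler_pdivlMr//; lra.
Qed.

Lemma angle_rays_le c e (D : R) : c 0 = e 0 -> 0 <= D ->
  (forall r, 0 <= r -> mdist (c r) (e r) <= D * r) -> angle c e <= 2 * D.
Proof.
move=> ce D0 h; rewrite /angle.
set l := limf_esup _ _.
suff : (l <= (2 * D)%:E)%E.
  by case: l => [r|//|_] /=; rewrite ?lee_fin// mulr_ge0.
apply: ge_ereal_inf; eexists.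
  exists ([set s : R | 0 < s] `*` [set s : R | 0 < s]) => //.
  exists ([set s : R | 0 < s], [set s : R | 0 < s]) => //=.
  by split; exact: nbhs_right_gt.
apply: ge_ereal_sup => _ [[s t] /= [s0 t0] <-].
by rewrite lee_fin; apply: comparison_angle_le.
Qed.

Lemma boundary_angle_ge0 (x y : ideal_boundary X) : 0 <= boundary_angle x y.
Proof.
rewrite /boundary_angle; set A := [set a | _].
have [[[a Aa] ubA]|nsup] := pselect (has_sup A); last by rewrite sup_out.
apply: (@le_trans _ _ a); last exact: ub_le_sup.
by case: Aa => p [c [e [cp ep _ _ ->]]]; apply: angle_rays_ge0; rewrite cp.
Qed.

(** Rays that diverge at linear speed at most D make an angle at most 2 D seen
    from every point: the additive error K disappears at infinity. *)
Lemma boundary_angle_le c e (D K : R) : 0 <= D ->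
  (forall r, 0 <= r -> mdist (c r) (e r) <= D * r + K) ->
  boundary_angle (endpoint c) (endpoint e) <= 2 * D.
Proof.
move=> D0 h; rewrite /boundary_angle.
set A := [set a | _].
have [A0|/set0P/negP] := pselect (A !=set0); last first.
  by rewrite negbK => /eqP ->; rewrite sup0 mulr_ge0.
apply: ge_sup => // _ [p [c' [e' [cp ep /endpoint_eq[K1 h1] /endpoint_eq[K2 h2] ->]]]].
apply: angle_rays_le; rewrite ?cp ?ep// => r.
rewrite le_eqVlt => /predU1P[<-|r0]; first by rewrite cp ep mdistxx mulr0.
apply/ler_addgt0Pr => eps eps0.
pose K' := `|K1 + K + K2|.
pose N := Num.max r (r * K' / eps).
have N0 : 0 < N by rewrite lt_max r0.
have rN : 0 <= r <= N by rewrite ltW//= le_max lexx.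
have l01 : 0 <= r / N <= 1.
  by rewrite divr_ge0 ?(ltW r0) ?(ltW N0)//= ler_pdivrMr// mul1r; case/andP: rN.
have gc := geodesic_between (ray_geodesic c' (ltW N0)) N0 rN.
have ge := geodesic_between (ray_geodesic e' (ltW N0)) N0 rN.
rewrite cp in gc; rewrite ep in ge.
apply: (le_trans (thales cat l01 gc ge)).
have dN : mdist (c' N) (e' N) <= D * N + K'.
  have := metric_triangle (c' N) (c N) (e' N); have := metric_triangle (c N) (e N) (e' N).
  have := h1 N (ltW N0); have := h2 N (ltW N0); rewrite (metric_sym (e' N)).
  have := h N (ltW N0); have := ler_norm (K1 + K + K2); rewrite -/K'; lra.
apply: (@le_trans _ _ (r / N * (D * N + K'))); first by rewrite ler_wpM2l//; case/andP: l01.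
have -> : r / N * (D * N + K') = D * r + r * K' / N by field; rewrite gt_eqF.
by rewrite lerD2l ler_pdivrMr// (mulrC eps) -ler_pdivrMr// le_max lexx orbT.
Qed.

End BoundaryAngle.

(** * Rays at finite Tits distance *)

Section TitsPath.
Context {R : realType} {X : metricType R}.
Hypotheses (proper : proper_space X) (cat : CAT0 X).

(** The directions at o of the points of the segments from c n to c' n: these
    segments leave every ball at linear speed, so that the direction of the point
    with parameter t has, as n grows, a limit that is Lipschitz in t. *)
Lemma exists_lipschitz_path (c c' : ray X) (k : R) : c 0 = c' 0 -> k < 2 ->
  (forall t, 0 <= t -> mdist (c t) (c' t) <= k * t) ->
  exists (e : R -> ray X) (C : R), [/\ 0 <= C, asymptotic (e 0) c,
    asymptotic (e 1) c' & forall s t r, 0 <= s <= 1 -> 0 <= t <= 1 -> 0 <= r ->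
    mdist (e s r) (e t r) <= C * `|s - t| * r].
Proof.
move=> cc' k2 h; have [U [UU oU]] := exists_ultrafilter.
pose o := c 0.
have k0 : 0 <= k by have := h 1 ler01; rewrite mulr1; apply/le_trans/mdist_ge0.
pose D (n : nat) := mdist (c n%:R) (c' n%:R).
have D0 n : 0 <= D n by exact: mdist_ge0.
have Dk n : D n <= k * n%:R by exact: h.
have /choice[s sP] : forall n : nat, exists s, is_geodesic (c n%:R) (c' n%:R) (D n) s.
  by move=> n; exact: exists_geodesic.
pose q n t := s n (t * D n).
have tD n t : 0 <= t <= 1 -> 0 <= t * D n <= D n.
  by move=> /andP[t0 t1]; rewrite mulr_ge0//= ler_piMl.
have dq n t u : 0 <= t <= 1 -> 0 <= u <= 1 -> mdist (q n t) (q n u) = `|t - u| * D n.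
  move=> t01 u01; rewrite /q; have [_ si _ _] := sP n.
  by rewrite (iso_segment si) ?tD// -mulrBl normrM (ger0_norm (D0 n)).
have q0 n : q n 0 = c n%:R by rewrite /q mul0r; have [] := sP n.
have q1 n : q n 1 = c' n%:R by rewrite /q mul1r; have [] := sP n.
have I0 : 0 <= (0 : R) <= 1 by rewrite lexx ler01.
have I1 : 0 <= (1 : R) <= 1 by rewrite lexx ler01.
pose dl := 1 - k / 2; have dl0 : 0 < dl by rewrite /dl; lra.
have oc n : mdist o (c n%:R) = n%:R.
  by rewrite ray_dist ?lexx// sub0r normrN ger0_norm.
have oc' n : mdist o (c' n%:R) = n%:R.
  by rewrite /o cc' ray_dist ?lexx// sub0r normrN ger0_norm.
(* The distances from q n t to c n and c' n add up to D n <= k n, whereas both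
   points are at distance n from o. *)
have oq n t : 0 <= t <= 1 -> dl * n%:R <= mdist o (q n t).
  move=> t01; have := dq n t 0 t01 I0; have := dq n t 1 t01 I1.
  rewrite q0 q1 subr0 distrC; case/andP: t01 => t0 t1.
  rewrite !ger0_norm ?subr_ge0// => e1 e0.
  have := metric_triangle o (q n t) (c n%:R); have := metric_triangle o (q n t) (c' n%:R).
  rewrite oc oc' e0 e1; have := Dk n; rewrite /dl; lra.
have /choice[G GP] : forall nt : nat * R, exists g,
    is_geodesic o (q nt.1 nt.2) (mdist o (q nt.1 nt.2)) g.
  by move=> nt; exact: exists_geodesic.
have far t r : 0 <= t <= 1 -> U [set n | r <= mdist o (q n t)].
  move=> t01; apply: filterS (ultra_ge oU (r / dl)) => n /= rn.
  apply: le_trans (oq n t t01); rewrite mulrC -ler_pdivrMr//.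
have /choice[e eP] : forall t, exists e : ray X, 0 <= t <= 1 ->
    e 0 = o /\ forall r, 0 <= r -> tends U (fun n => G (n, t) r) (e r).
  move=> t; have [t01|nt01] := boolP (0 <= t <= 1); last by exists c.
  have [e eP] := limit_ray proper UU (fun n => GP (n, t)) (fun r => far t r t01).
  by exists e.
exists e, (2 * k / dl); split.
- by rewrite divr_ge0 ?mulr_ge0// ltW.
- exists 0 => r r0; have [_ /(_ r r0) er] := eP 0 I0.
  apply: (tends_le UU er (tends_cst UU (c r))) => eps eps0.
  apply: filterS (filterI (far 0 (r + 1) I0) (ultra_ge oU r)) => n /= [rq rn].
  have gg := GP (n, 0); rewrite /= q0 in gg rq.
  have gc := ray_geodesic c (ler0n R n).
  have H := fellow_travel cat gg gc (r := r); rewrite !mdistxx mulr0 !addr0 in H.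
  by apply: (le_trans (H _ _ _)); rewrite ?r0 ?add0r ?(ltW eps0)//=; lra.
- exists 0 => r r0; have [_ /(_ r r0) er] := eP 1 I1.
  apply: (tends_le UU er (tends_cst UU (c' r))) => eps eps0.
  apply: filterS (filterI (far 1 (r + 1) I1) (ultra_ge oU r)) => n /= [rq rn].
  have gg := GP (n, 1); rewrite /= q1 in gg rq.
  have gc := ray_geodesic c' (ler0n R n); rewrite -cc' in gc.
  have H := fellow_travel cat gg gc (r := r); rewrite !mdistxx mulr0 !addr0 in H.
  by apply: (le_trans (H _ _ _)); rewrite ?r0 ?add0r ?(ltW eps0)//=; lra.
- move=> t u r t01 u01 r0.
  have [_ /(_ r r0) et] := eP t t01; have [_ /(_ r r0) eu] := eP u u01.
  apply: (tends_le UU et eu) => eps eps0.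
  apply: filterS (filterI (ultra_ge oU 1) (filterI (far t r t01) (far u r u01))).
  move=> n /= [n1 [rt ru]].
  have n0 : 0 < n%:R :> R by apply: lt_le_trans n1.
  have L0 : 0 < mdist o (q n t) by apply: lt_le_trans (oq n t t01); rewrite mulr_gt0.
  have := fellow_travel cat (GP (n, t)) (GP (n, u)) L0 (r := r).
  rewrite r0 /= => /(_ rt ru) H; apply: (le_trans H).
  rewrite mdistxx add0r dq//.
  have h1 : r / mdist o (q n t) <= r / (dl * n%:R).
    by rewrite ler_wpM2l// lef_pV2 ?posrE ?mulr_gt0// oq.
  have h2 : 2 * (r / mdist o (q n t)) * (`|t - u| * D n) <=
            2 * (r / (dl * n%:R)) * (`|t - u| * (k * n%:R)).
    apply: ler_pM.
    - by rewrite mulr_ge0// divr_ge0// mdist_ge0.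
    - by rewrite mulr_ge0.
    - exact: ler_wpM2l.
    - exact: ler_wpM2l.
  apply: (le_trans h2); apply: (@le_trans _ _ (2 * k / dl * `|t - u| * r)); last lra.
  rewrite le_eqVlt; apply/orP; left; apply/eqP; field.
  by rewrite !gt_eqF.
Qed.

(** The Lipschitz bounds telescope over a partition. *)
Lemma boundary_length_le (g : R -> ideal_boundary X) (C : R) :
  (forall s t, 0 <= s <= 1 -> 0 <= t <= 1 -> boundary_angle (g s) (g t) <= C * `|s - t|) ->
  (boundary_length g <= C%:E)%E.
Proof.
move=> h; apply: ge_ereal_sup => _ [s sP <-].
rewrite lee_fin.
have I i : (i < (size s).+1)%N -> 0 <= nth 1 (0 :: s) i <= 1.
  by move=> si; rewrite (itv_partition_nth_ge si sP) (itv_partition_nth_le si sP).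
apply: (@le_trans _ _ (\sum_(0 <= i < size s)
    (C * nth 1 (0 :: s) i.+1 - C * nth 1 (0 :: s) i))).
  apply: ler_sum_nat => i /andP[_ si].
  have lt : nth 1 (0 :: s) i < nth 1 (0 :: s) i.+1.
    by case: sP => /(pathP 1) /(_ i si).
  apply: (le_trans (h _ _ (I i _) (I i.+1 _))); rewrite ?ltnS//; first exact: ltnW.
  by rewrite distrC gtr0_norm ?subr_gt0// mulrBr.
rewrite telescope_sumr//= mulr0 subr0.
have -> : nth 1 (0 :: s) (size s) = 1.
  by case: sP => _ /eqP; rewrite (last_nth 1).
by rewrite mulr1.
Qed.

Lemma tits_distance_lt_pinfty (c c' : ray X) (k : R) : c 0 = c' 0 -> k < 2 ->
  (forall t, 0 <= t -> mdist (c t) (c' t) <= k * t) ->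
  (tits_distance (endpoint c) (endpoint c') < +oo)%E.
Proof.
move=> cc' k2 h.
have [e [C [C0 e0 e1 eL]]] := exists_lipschitz_path cc' k2 h.
pose g t := endpoint (e t).
have gL s t : 0 <= s <= 1 -> 0 <= t <= 1 ->
    boundary_angle (g s) (g t) <= 2 * C * `|s - t|.
  move=> s01 t01; rewrite -mulrA; apply: (@boundary_angle_le _ _ cat _ _ _ 0).
    by rewrite mulr_ge0.
  by move=> r r0; rewrite addr0 eL.
apply: (@le_lt_trans _ _ (2 * C)%:E); last exact: ltry.
apply: le_trans (boundary_length_le gL).
apply: ereal_inf_lbound; exists g => //; split; first exact/endpoint_eq.
  exact/endpoint_eq.
move=> t; rewrite in_itv/= => t01.
apply/cvgrPdist_le => eps eps0.
have d0 : 0 < eps / (2 * C + 1) by rewrite divr_gt0// ltr_wpDl// mulr_ge0.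
exists (eps / (2 * C + 1)) => //= s /= ts s01.
rewrite sub0r normrN ger0_norm ?boundary_angle_ge0//.
apply: (le_trans (gL _ _ t01 _)); first by rewrite in_itv/= in s01.
have ts' := ltW ts; rewrite ler_pdivlMr ?ltr_wpDl ?mulr_ge0// in ts'.
by have := normr_ge0 (t - s); lra.
Qed.

(** Visibility enters the proof only here: rays with different endpoints
    separate at the maximal speed 2. *)
Lemma visible_endpoint_eq (c c' : ray X) (k : R) : visible X ->
  c 0 = c' 0 -> k < 2 ->
  (forall t, 0 <= t -> mdist (c t) (c' t) <= k * t) -> endpoint c = endpoint c'.
Proof.
move=> vis cc' k2 h; apply/eqP; apply: contraT => /vis E.
by have := tits_distance_lt_pinfty cc' k2 h; rewrite E ltxx.
Qed.

End TitsPath.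

(** * Visibility *)

Section Visibility.
Context {R : realType} {X : metricType R}.
Hypotheses (proper : proper_space X) (cat : CAT0 X).

Lemma exists_nearest_point (o x y : X) (L : R) (g : R -> X) :
  is_geodesic x y L g ->
  exists2 t, 0 <= t <= L & forall s, 0 <= s <= L -> mdist o (g t) <= mdist o (g s).
Proof.
move=> gg; have [L0 gi _ _] := gg.
have [|t tL tmin] := @EVT_min R (fun t => mdist o (g t)) 0 L L0.
  apply/subspace_continuousP => t /=; rewrite in_itv/= => tL.
  apply/cvgrPdist_le => eps eps0; exists eps => //= s /= ts; rewrite in_itv/= => sL.
  have st := iso_segment gi tL sL.
  have := metric_triangle o (g t) (g s); have := metric_triangle o (g s) (g t).
  by rewrite (metric_sym (g s)) st /from_subspace ler_norml => h1 h2; move: (ltW ts) => h3; apply/andP; split; lra.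
rewrite in_itv/= in tL.
by exists t => // s sL; apply: tmin; rewrite in_itv.
Qed.

(** The angle at m between [m, o] and [m, y] is not acute when the points of
    [m, y] near m are not nearer to o than m: the first-order term in l of
    [stewart] gives the inequality of Pythagoras. *)
Lemma nearest_point_obtuse (o m y : X) :
  (forall l, 0 < l <= 1 -> exists p, between l m y p /\ mdist o m <= mdist o p) ->
  mdist o m ^+ 2 + mdist m y ^+ 2 <= mdist o y ^+ 2.
Proof.
move=> h; apply/ler_addgt0Pr => eps eps0.
set a := mdist o m; set b := mdist m y; set c := mdist o y.
pose l := Num.min 1 (eps / (b ^+ 2 + 1)).
have b1 : 0 < b ^+ 2 + 1 by rewrite ltr_wpDl// sqr_ge0.
have l0 : 0 < l by rewrite lt_min ltr01 divr_gt0.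
have l1 : l <= 1 by rewrite ge_min lexx.
have lb : l * b ^+ 2 <= eps.
  apply: (@le_trans _ _ (l * (b ^+ 2 + 1))); first by rewrite ler_wpM2l ?lerDl// ltW.
  by rewrite -ler_pdivlMr// ge_min lexx orbT.
have [|p [mp op]] := h l; first by rewrite l0.
have := stewart cat (l := l) (p := p) o; rewrite (ltW l0) l1 => /(_ _ _ isT mp).
rewrite (metric_sym p) (metric_sym m o) (metric_sym y o) -/a -/b -/c => H.
have {}op : a ^+ 2 <= mdist o p ^+ 2 by rewrite ler_pXn2r// nnegrE mdist_ge0.
have : l * (a ^+ 2 + b ^+ 2 - c ^+ 2 - l * b ^+ 2) <= 0 by lra.
by rewrite pmulr_rle0//; lra.
Qed.

Lemma nearest_point_pythagoras (o x y : X) (L t : R) (g : R -> X) :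
  is_geodesic x y L g -> 0 <= t <= L ->
  (forall s, 0 <= s <= L -> mdist o (g t) <= mdist o (g s)) ->
  mdist o (g t) ^+ 2 + mdist (g t) x ^+ 2 <= mdist o x ^+ 2 /\
  mdist o (g t) ^+ 2 + mdist (g t) y ^+ 2 <= mdist o y ^+ 2.
Proof.
move=> gg tL tmin; have [L0 gi g0 gL] := gg; case/andP: (tL) => t0 tL'.
split; apply: nearest_point_obtuse => l /andP[l0 l1].
- have lt0 : 0 <= l * t by rewrite mulr_ge0// ltW.
  have lt1 : l * t <= t by rewrite ler_piMl.
  have I : 0 <= t - l * t <= L by apply/andP; split; lra.
  exists (g (t - l * t)); split; last exact: tmin.
  rewrite -g0 /between metric_sym (metric_sym (g t)) (metric_sym _ (g 0)).
  by rewrite !(geodesic_dist gg)//; try lra; split; ring.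
- have lt0 : 0 <= l * (L - t) by rewrite mulr_ge0 ?subr_ge0// ltW.
  have lt1 : l * (L - t) <= L - t by rewrite ler_piMl ?subr_ge0.
  have I : 0 <= t + l * (L - t) <= L by apply/andP; split; lra.
  exists (g (t + l * (L - t))); split; last exact: tmin.
  rewrite -gL /between.
  by rewrite !(geodesic_dist gg)//; try lra; split; ring.
Qed.

(** The comparison angle at o is at most pi / 2, so that points at distance r
    from o on the two sides are at most sqrt 2 * r apart; 3 / 2 is a rational
    bound of sqrt 2 that is less than 2. *)
Lemma right_angle_dist (o x y : X) (L L' r : R) (g g' : R -> X) :
  is_geodesic o x L g -> is_geodesic o y L' g' ->
  mdist x y ^+ 2 <= L ^+ 2 + L' ^+ 2 -> 0 < r -> r <= L -> r <= L' ->
  mdist (g r) (g' r) <= 3 / 2 * r.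
Proof.
move=> gg gg' h r0 rL rL'.
have L0 : 0 < L by lra.
have L0' : 0 < L' by lra.
have b1 : between (r / L) o x (g r) by apply: geodesic_between => //; rewrite ltW.
have b2 : between (r / L') o y (g' r) by apply: geodesic_between => //; rewrite ltW.
have l1 : 0 <= r / L <= 1 by rewrite divr_ge0 ?(ltW r0) ?(ltW L0)//= ler_pdivrMr// mul1r.
have l2 : 0 <= r / L' <= 1 by rewrite divr_ge0 ?(ltW r0) ?(ltW L0')//= ler_pdivrMr// mul1r.
have := comparison cat l1 l2 b1 b2.
rewrite (geodesic_length gg) (geodesic_length gg') => H.
apply: le_of_sqr; first by lra.
apply: (le_trans H).
have -> : (r / L) ^+ 2 * L ^+ 2 = r ^+ 2 by field; rewrite gt_eqF.
have -> : (r / L') ^+ 2 * L' ^+ 2 = r ^+ 2 by field; rewrite gt_eqF.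
have : 0 <= r / L * (r / L') * (L ^+ 2 + L' ^+ 2 - mdist x y ^+ 2).
  by rewrite mulr_ge0 ?subr_ge0// mulr_ge0//; [case/andP: l1|case/andP: l2].
have := sqr_ge0 r; rewrite exprMn; lra.
Qed.

(** The points x n tend to the endpoint of c, because their distance from c (T n)
    is small compared with T n, and the angle at c 0 between m n and x n is at most
    pi / 2; so the same holds for the limits e of m n and c of x n. *)
Lemma limit_perpendicular (U : set_system nat) (UU : UltraFilter U) (oU : \oo `<=` U)
  (c e : ray X) (m x : nat -> X) (T : nat -> R) (G : nat -> R -> X) :
  (forall n, is_geodesic (c 0) (m n) (mdist (c 0) (m n)) (G n)) ->
  (forall r, 0 <= r -> tends U (fun n => G n r) (e r)) -> c 0 = e 0 ->
  (forall n, n.+1%:R <= T n) ->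
  (forall n, mdist (x n) (c (T n)) <= T n / n.+1%:R) ->
  (forall n, n.+1%:R <= mdist (c 0) (m n)) ->
  (forall n, mdist (m n) (x n) ^+ 2 <= mdist (c 0) (m n) ^+ 2 + mdist (c 0) (x n) ^+ 2) ->
  forall r, 0 <= r -> mdist (c r) (e r) <= 3 / 2 * r.
Proof.
move=> GP Ge ce hT hx hm hp r; rewrite le_eqVlt => /predU1P[<-|r0].
  by rewrite ce mdistxx mulr0.
apply: (tends_le UU (tends_cst UU (c r)) (Ge r (ltW r0))) => eps eps0.
apply: filterS (filterI (ultra_ge oU r) (ultra_ge oU (2 * r / eps))) => n /= [rn rn'].
have nn : n%:R <= n.+1%:R :> R by rewrite ler_nat.
have n0 : 0 < n.+1%:R :> R by rewrite ltr0n.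
have T0 : 0 < T n by apply: lt_le_trans (hT n).
have gc := ray_geodesic c (ltW T0).
have [g gP] := exists_geodesic cat (c 0) (x n).
have rx : r <= mdist (c 0) (x n).
  have := metric_triangle (c 0) (x n) (c (T n)); rewrite (geodesic_length gc).
  have : T n / n.+1%:R <= T n - n%:R.
    rewrite ler_pdivrMr//; have := hT n; rewrite -(natr1 n) => h.
    have : 0 <= n%:R * (T n - (n%:R + 1)) by rewrite mulr_ge0// subr_ge0.
    lra.
  by have := hx n; move: (T n / _) => z; lra.
have rT : 0 <= r <= T n by have := hT n => h; apply/andP; split; lra.
have rm : r <= mdist (c 0) (m n) by have := hm n; lra.
have h1 := fellow_travel cat gc gP T0 rT rx.
have h2 := @right_angle_dist _ _ _ _ _ r _ _ (GP n) gP (hp n) r0 rm rx.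
have h3 : 2 * (r / T n) * mdist (c (T n)) (x n) <= 2 * r / n.+1%:R.
  rewrite metric_sym; apply: (@le_trans _ _ (2 * (r / T n) * (T n / n.+1%:R))).
    by rewrite ler_wpM2l// mulr_ge0// divr_ge0 ?ltW.
  rewrite le_eqVlt; apply/orP; left; apply/eqP; field.
  by rewrite nat1r !gt_eqF.
have h4 : 2 * r / n.+1%:R <= eps.
  rewrite ler_pdivrMr// (mulrC eps) -ler_pdivrMr//; lra.
rewrite mdistxx add0r in h1; have h5 := le_trans h1 (le_trans h3 h4).
have := metric_triangle (c r) (g r) (G n r); rewrite (metric_sym (g r)); lra.
Qed.

(** Otherwise there are geodesics for which the feet of the perpendiculars from
    c 0 escape to infinity; a limit direction of these makes an angle at most
    pi / 2 with both rays and so, by [visible_endpoint_eq], has the endpoint of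
    both. Asking the ends x and y to be near the rays only relative to T covers
    segments of lines at an arbitrary distance from c 0. *)
Lemma visibility (c c' : ray X) : visible X -> c 0 = c' 0 ->
  endpoint c <> endpoint c' ->
  exists N : nat, forall (T : R) (x y : X) (L : R) (g : R -> X),
    N.+1%:R <= T -> mdist x (c T) <= T / N.+1%:R -> mdist y (c' T) <= T / N.+1%:R ->
    is_geodesic x y L g ->
    exists2 t, 0 <= t <= L & mdist (c 0) (g t) <= N.+1%:R.
Proof.
move=> vis cc' ncc'; apply: contra_notP ncc' => H.
have [U [UU oU]] := exists_ultrafilter.
have /choice[F FP] : forall n : nat, exists F : R * (X * X) * X,
    let: (T, (x, y), m) := F in
    [/\ n.+1%:R <= T, mdist x (c T) <= T / n.+1%:R, mdist y (c' T) <= T / n.+1%:R,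
        n.+1%:R <= mdist (c 0) m &
        mdist m x ^+ 2 <= mdist (c 0) m ^+ 2 + mdist (c 0) x ^+ 2 /\
        mdist m y ^+ 2 <= mdist (c 0) m ^+ 2 + mdist (c 0) y ^+ 2].
  move=> n; apply: contra_notP H => H; exists n => T x y L g hT hx hy gg.
  have [t tL tmin] := exists_nearest_point (c 0) gg.
  exists t => //; rewrite leNgt; apply/negP => far; apply: H.
  exists (T, (x, y), g t); split=> //; first exact: ltW.
  have [h1 h2] := nearest_point_pythagoras gg tL tmin.
  by have := sqr_ge0 (mdist (c 0) (g t)); split; lra.
pose T n := (F n).1.1; pose x n := (F n).1.2.1; pose y n := (F n).1.2.2; pose m n := (F n).2.
have {}FP n : [/\ n.+1%:R <= T n, mdist (x n) (c (T n)) <= T n / n.+1%:R,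
    mdist (y n) (c' (T n)) <= T n / n.+1%:R, n.+1%:R <= mdist (c 0) (m n) &
        mdist (m n) (x n) ^+ 2 <= mdist (c 0) (m n) ^+ 2 + mdist (c 0) (x n) ^+ 2 /\
        mdist (m n) (y n) ^+ 2 <= mdist (c 0) (m n) ^+ 2 + mdist (c 0) (y n) ^+ 2].
  by have := FP n; rewrite /T /x /y /m; case: (F n) => [[? [? ?]] ?].
have /choice[G GP] : forall n, exists g, is_geodesic (c 0) (m n) (mdist (c 0) (m n)) g.
  by move=> n; exact: exists_geodesic.
have far r : U [set n | r <= mdist (c 0) (m n)].
  apply: filterS (ultra_ge oU r) => n /= rn; have [_ _ _ h _] := FP n.
  by apply: (le_trans rn); apply: le_trans h; rewrite ler_nat.
have [e [e0 eP]] := limit_ray proper UU GP far.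
have k2 : 3 / 2 < 2 :> R by lra.
have -> : endpoint c = endpoint e.
  apply: (visible_endpoint_eq proper cat vis (esym e0) k2).
  by apply: (limit_perpendicular (x := x) (T := T) UU oU GP eP (esym e0)) => n; have [? ? ? ? []] := FP n.
apply/esym; rewrite cc' in GP e0 FP.
apply: (visible_endpoint_eq proper cat vis (esym e0) k2).
by apply: (limit_perpendicular (x := y) (T := T) UU oU GP eP (esym e0)) => n; have [? ? ? ? []] := FP n.
Qed.

End Visibility.

(** * Isometries with minimal displacement *)

Section Axis.
Context {R : realType} {X : metricType R}.
Hypotheses (proper : proper_space X) (cat : CAT0 X).
Variable f : self_isometry X.
Implicit Types (S : set X) (p q x y : X).

Definition midpoint_closed S : Prop :=
  forall p q, S p -> S q -> exists2 m, S m & between (1 / 2) p q m.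

(** The midpoints m of [p, h p] and h m of [h p, h (h p)] are at most half as far
    apart as p and h (h p). *)
Lemma displacement_square S (h : X -> X) (a : R) :
  (forall x y, mdist (h x) (h y) = mdist x y) -> (forall x, S x -> S (h x)) ->
  midpoint_closed S -> (forall x, S x -> a <= mdist x (h x)) ->
  forall x, S x -> 2 * a <= mdist x (h (h x)).
Proof.
move=> hi hS mS ha x Sx.
have [m Sm xm] := mS _ _ Sx (hS _ Sx).
have hm : between (1 / 2) (h x) (h (h x)) (h m) by case: xm => h1 h2; split; rewrite !hi.
have := between_sym xm; have -> : 1 - 1 / 2 = 1 / 2 :> R by field.
move=> mx; have l01 : 0 <= (1 / 2 : R) <= 1 by lra.
have := thales cat l01 mx hm; have := ha _ Sm; lra.
Qed.

Lemma iter_iso_dist n x y : mdist (iter n f x) (iter n f y) = mdist x y.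
Proof. by elim: n => //= n IH; rewrite iso_dist. Qed.

Lemma iter_dist_le n x : mdist x (iter n f x) <= n%:R * mdist x (f x).
Proof.
elim: n => [|n IH]; first by rewrite mdistxx mul0r.
have := metric_triangle x (iter n f x) (iter n.+1 f x).
by rewrite iterSr iter_iso_dist -natr1 mulrDl mul1r -iterSr; lra.
Qed.

(** Doubling the time doubles the minimal displacement; the triangle inequality
    then leaves no room for a shorter intermediate time. *)
Lemma orbit_dist S p : (forall x, S x -> S (f x)) -> midpoint_closed S -> S p ->
  (forall x, S x -> mdist p (f p) <= mdist x (f x)) ->
  forall n, mdist p (iter n f p) = n%:R * mdist p (f p).
Proof.
move=> fS mS Sp pmin n; set a := mdist p (f p) in pmin *.
have iS k x : S x -> S (iter k f x) by move=> Sx; elim: k => //= k; exact: fS.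
have pow k x : S x -> (2 ^ k)%N%:R * a <= mdist x (iter (2 ^ k) f x).
  elim: k x => [|k IH] x Sx; first by rewrite mul1r; exact: pmin.
  have := displacement_square (iter_iso_dist (2 ^ k)) (iS (2 ^ k)%N) mS IH Sx.
  by rewrite -iterD addnn -mul2n -expnS mulrA -natrM -expnS.
apply/eqP; rewrite eq_le iter_dist_le /=.
have nk : (n <= 2 ^ n)%N by apply: ltnW; exact: ltn_expl.
have := metric_triangle p (iter n f p) (iter (2 ^ n) f p).
have -> : mdist (iter n f p) (iter (2 ^ n) f p) = mdist p (iter (2 ^ n - n) f p).
  by rewrite -[in LHS](subnKC nk) iterD iter_iso_dist.
have := pow n p Sp.
have := iter_dist_le (2 ^ n - n) p; rewrite natrB// -/a; lra.
Qed.

Lemma exists_inverse : exists g : X -> X, cancel f g /\ cancel g f.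
Proof.
have /choice[g gP] : forall y, exists x, f x = y.
  by move=> y; have [x _ <-] := @iso_surj _ _ f y I; exists x.
exists g; split=> x; last exact: gP.
by apply: mdist_positivity; rewrite -(iso_dist f) gP mdistxx.
Qed.

Section IntegerPowers.
Variable g : X -> X.
Hypotheses (fK : cancel f g) (gK : cancel g f).

Definition iterz (k : int) : X -> X :=
  match k with Posz n => iter n f | Negz n => iter n.+1 g end.

Lemma iterzS k x : iterz (k + 1) x = f (iterz k x).
Proof.
case: k => [n|[|n]].
- by rewrite (_ : Posz n + 1 = Posz n.+1)//; lia.
- by rewrite (_ : Negz 0 + 1 = 0)//= gK.
- rewrite (_ : Negz n.+1 + 1 = Negz n); last by lia.
  by rewrite /= gK.
Qed.

Lemma iterz_f k x : iterz k (f x) = f (iterz k x).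
Proof.
case: k => n /=; first by rewrite -iterSr.
elim: n => [|n IH] /=; first by rewrite fK gK.
by rewrite IH fK gK.
Qed.

Lemma iterz_dist k x y : mdist (iterz k x) (iterz k y) = mdist x y.
Proof.
case: k => n; first exact: iter_iso_dist.
have gi u v : mdist (g u) (g v) = mdist u v by rewrite -(iso_dist f) !gK.
by rewrite /= gi; elim: n => //= n IH; rewrite gi.
Qed.

Lemma iterzD k n x : iterz (k + Posz n) x = iterz k (iter n f x).
Proof.
elim: n k => [|n IH] k; first by rewrite addr0.
by rewrite (_ : k + n.+1 = k + 1 + n); [rewrite IH iterzS iterz_f|lia].
Qed.

(** The geodesic from p to f p and its images under the powers of f fit together
    into a line as soon as the orbit of p is evenly spaced. *)
Lemma evenly_spaced_hyperbolic p : 0 < mdist p (f p) ->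
  (forall n, mdist p (iter n f p) = n%:R * mdist p (f p)) -> hyperbolic f.
Proof.
set a := mdist p (f p) => a0 orb.
have [s sP] := exists_geodesic cat p (f p); rewrite -/a in sP.
have [_ _ s0 sa] := sP.
pose k (t : R) := Num.floor (t / a).
pose c (t : R) := iterz (k t) (s (t - (k t)%:~R * a)).
have kP t : 0 <= t - (k t)%:~R * a /\ t - (k t)%:~R * a < a.
  have /andP[] := floor_itv (t / a); rewrite -/(k t).
  by rewrite ler_pdivlMr// ltr_pdivrMr// intrD mulrDl mul1r; lra.
have cle t u : t <= u -> mdist (c t) (c u) = u - t.
  move=> tu; have [t0 ta] := kP t; have [u0 ua] := kP u.
  have : (k t <= k u)%R by apply: le_floor; rewrite ler_pM2r ?invr_gt0.
  rewrite -subr_ge0; case E : (k u - k t) => [n|//] _.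
  have ku : k u = k t + Posz n by rewrite -E addrC subrK.
  have kuR : (k u)%:~R = (k t)%:~R + n%:R :> R by rewrite ku intrD.
  rewrite /c.
  set r := t - (k t)%:~R * a in t0 ta *; set v := u - (k u)%:~R * a in u0 ua *.
  have uvt : u - t = v - r + n%:R * a by rewrite /v /r kuR; lra.
  rewrite ku iterzD iterz_dist uvt {ku kuR E}.
  case: n uvt => [|n] uvt.
    by rewrite mul0r addr0 in uvt *; rewrite (geodesic_dist sP)//; lra.
  (* The orbit points p before c t and f^(n+2) p after c u, up to a power of f, are
     as far apart as the path through c t and c u is long, so that the triangle inequalities are
     equalities. *)
  have d1 : mdist (s r) (f p) = a - r by rewrite -sa (geodesic_dist sP)//; lra.
  have d2 : mdist (f p) (iter n.+1 f p) = n%:R * a.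
    by rewrite iterSr -(orb n) -[in RHS](iso_dist f) -iterSr /=.
  have d3 : mdist (iter n.+1 f p) (iter n.+1 f (s v)) = v.
    by rewrite iter_iso_dist -{1}s0 (geodesic_dist sP) ?subr0//; lra.
  have d4 : mdist p (s r) = r by rewrite -{1}s0 (geodesic_dist sP) ?subr0//; lra.
  have d5 : mdist (iter n.+1 f (s v)) (iter n.+2 f p) = a - v.
    by rewrite (iterSr n.+1) iter_iso_dist -sa (geodesic_dist sP)//; lra.
  have := metric_triangle (s r) (f p) (iter n.+1 f (s v)).
  have := metric_triangle (f p) (iter n.+1 f p) (iter n.+1 f (s v)).
  have := metric_triangle p (s r) (iter n.+2 f p).
  have := metric_triangle (s r) (iter n.+1 f (s v)) (iter n.+2 f p).
  rewrite d1 d2 d3 d4 d5 (orb n.+2) -!natr1 => h1 h2 h3 h4.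
  by apply/eqP; rewrite eq_le; apply/andP; split; lra.
exists c, a; split.
- move=> t u _ _; have [tu|/ltW ut] := leP t u.
    by rewrite cle// distrC ger0_norm// subr_ge0.
  by rewrite metric_sym cle// ger0_norm// subr_ge0.
- by rewrite gt_eqF.
- move=> t; rewrite /c.
  have -> : k (t + a) = k t + 1.
    rewrite /k mulrDl divff ?gt_eqF// floorDrz ?rpred1// floor1//.
  rewrite iterzS; congr (f (iterz _ (s _))).
  by rewrite intrD; ring.
Qed.

End IntegerPowers.

Lemma minimal_displacement_semisimple S p :
  (forall x, S x -> S (f x)) -> midpoint_closed S -> S p ->
  (forall x, S x -> mdist p (f p) <= mdist x (f x)) -> elliptic f \/ hyperbolic f.
Proof.
move=> fS mS Sp pmin; have orb := orbit_dist fS mS Sp pmin.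
have := mdist_ge0 p (f p); rewrite le_eqVlt => /predU1P[e0|a0].
  by left; exists p; apply/esym/mdist_positivity.
right; have [g [fK gK]] := exists_inverse.
exact: (evenly_spaced_hyperbolic fK gK a0 orb).
Qed.

(** The points q form a minimizing sequence in a bounded part of S, where it has
    a limit. *)
Lemma exists_minimal_displacement S (U : set_system nat) (UU : UltraFilter U)
  (oU : \oo `<=` U) (o : X) (K : R) : S !=set0 ->
  (forall p, S p -> exists q,
     [/\ S q, mdist q (f q) <= mdist p (f p) & mdist o q <= K]) ->
  (forall u x, (forall n, S (u n)) -> (forall n, mdist o (u n) <= K) ->
     tends U u x -> S x) ->
  exists2 p, S p & forall x, S x -> mdist p (f p) <= mdist x (f x).
Proof.
move=> [p0 Sp0] bd cl.
pose A := [set mdist x (f x) | x in S].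
have A0 : A !=set0 by exists (mdist p0 (f p0)), p0.
have lbA : has_inf A by split=> //; exists 0 => _ [x _ <-]; exact: mdist_ge0.
have /choice[u uP] : forall n : nat, exists q,
    [/\ S q, mdist q (f q) <= inf A + n.+1%:R^-1 & mdist o q <= K].
  move=> n; have n0 : 0 < n.+1%:R^-1 :> R by rewrite invr_gt0.
  have [_ [p Sp <-] plt] := inf_adherent n0 lbA.
  by have [q [Sq qp oq]] := bd p Sp; exists q; split=> //; exact: le_trans qp (ltW plt).
have [|x ux] := @tends_exists _ _ proper U UU u o K.
  by apply: ultra_all => n; case: (uP n).
exists x.
  by apply: (cl u) => // n; case: (uP n).
move=> y Sy; apply: (@le_trans _ _ (inf A)); last first.
  by apply: ge_inf => //; [case: lbA|exists y].
apply: (tends_le UU ux (tends_iso UU f ux)) => e e0.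
apply: filterS (ultra_ge oU e^-1) => n /= en; have [_ h _] := uP n.
apply: (le_trans h); rewrite lerD2l -[leRHS]invrK lef_pV2 ?posrE ?invr_gt0//.
by apply: (le_trans en); rewrite ler_nat.
Qed.

(** Otherwise displacement would attain its minimum on the whole space. *)
Lemma parabolic_escape (o : X) : parabolic f -> forall n : nat, exists p,
  mdist p (f p) <= mdist o (f o) /\ n%:R <= mdist o p.
Proof.
move=> [nell nhyp] n; apply: contrapT => H.
have [U [UU oU]] := exists_ultrafilter.
have [||//|p _ pmin] := @exists_minimal_displacement setT U UU oU o n%:R; first by exists o.
- move=> p _; have [po|/ltW op] := leP (mdist p (f p)) (mdist o (f o)).
    exists p; split=> //; rewrite leNgt; apply/negP => far; apply: H.
    by exists p; split=> //; exact: ltW.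
  by exists o; rewrite mdistxx.
have mid : midpoint_closed setT.
  by move=> x y _ _; have [|m xm] := @exists_between _ _ cat (1 / 2) x y; [lra|exists m].
by have [] := minimal_displacement_semisimple (fun x _ => I) mid I pmin.
Qed.

(** Displacement is convex, hence at most d(o, f o) along the geodesics to the
    escaping points, and along the limit ray. *)
Lemma parabolic_fixes_ray (o : X) : parabolic f ->
  exists c : ray X, asymptotic (iso_ray f c) c.
Proof.
move=> /(parabolic_escape o)/choice[q qP].
have [U [UU oU]] := exists_ultrafilter.
have /choice[G GP] : forall n, exists g, is_geodesic o (q n) (mdist o (q n)) g.
  by move=> n; exact: exists_geodesic.
have far r : U [set n | r <= mdist o (q n)].
  by apply: filterS (ultra_ge oU r) => n /= rn; apply: (le_trans rn); case: (qP n).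
have [c [c0 cG]] := limit_ray proper UU GP far.
exists c, (mdist o (f o)) => r r0; rewrite metric_sym.
apply: (tends_le UU (cG r r0) (tends_iso UU f (cG r r0))) => e e0.
apply: filterS (filterI (far r) (far 1)) => n /= [rn n1].
have L0 : 0 < mdist o (q n) by apply: lt_le_trans n1.
have rL : 0 <= r <= mdist o (q n) by rewrite r0.
have b := geodesic_between (GP n) L0 rL.
have b' : between (r / mdist o (q n)) (f o) (f (q n)) (f (G n r)).
  by case: b => h1 h2; split; rewrite !iso_dist.
have l01 : 0 <= r / mdist o (q n) <= 1.
  by rewrite divr_ge0 ?(ltW L0)//= ler_pdivrMr// mul1r.
have [h _] := qP n; have := dist_convex cat l01 b b'.
case/andP: l01; move: (r / _) => l l0 l1.
by have := ler_wpM2l l0 h; lra.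
Qed.

End Axis.

(** * Parallel lines *)

Section Geodesics.
Context {R : realType} {X : metricType R}.

Lemma geodesic_tail (x y : X) (L t : R) (g : R -> X) : is_geodesic x y L g ->
  0 <= t <= L -> is_geodesic (g t) y (L - t) (fun r => g (r + t)).
Proof.
move=> [L0 gi g0 gL] /andP[t0 tL]; split; rewrite ?subr_ge0 ?add0r ?subrK//.
move=> r s /=; rewrite !in_itv/= => /andP[r0 rL] /andP[s0 sL].
rewrite (iso_segment gi); first by congr `| _ |; ring.
  by apply/andP; split; lra.
by apply/andP; split; lra.
Qed.

Lemma geodesic_head_rev (x y : X) (L t : R) (g : R -> X) : is_geodesic x y L g ->
  0 <= t <= L -> is_geodesic (g t) x t (fun r => g (t - r)).
Proof.
move=> [L0 gi g0 gL] /andP[t0 tL]; split; rewrite ?subr0 ?subrr//.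
move=> r s /=; rewrite !in_itv/= => /andP[r0 rL] /andP[s0 sL].
rewrite (iso_segment gi); first by rewrite distrC; congr `| _ |; ring.
  by apply/andP; split; lra.
by apply/andP; split; lra.
Qed.

Lemma line_segment (c : R -> X) (s t : R) : is_line c -> s <= t ->
  is_geodesic (c s) (c t) (t - s) (fun r => c (r + s)).
Proof.
move=> cl st; split; rewrite ?subr_ge0 ?add0r ?subrK// => u v _ _.
by rewrite cl//; congr `| _ |; ring.
Qed.

Lemma line_shift (c : R -> X) (u : R) : is_line c -> is_line (fun t => c (t + u)).
Proof. by move=> cl s t _ _; rewrite cl//; congr `| _ |; ring. Qed.

Lemma line_rev (c : R -> X) : is_line c -> is_line (fun t => c (- t)).
Proof. by move=> cl s t _ _; rewrite cl// distrC; congr `| _ |; ring. Qed.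

End Geodesics.

Section Lines.
Context {R : realType} {X : metricType R}.
Hypotheses (proper : proper_space X) (cat : CAT0 X).

(** A bounded convex function on a half-line is nonincreasing. *)
Lemma parallel_dist_le (c c' : R -> X) (K s t : R) : is_line c -> is_line c' ->
  (forall t, mdist (c t) (c' t) <= K) -> s <= t ->
  mdist (c t) (c' t) <= mdist (c s) (c' s).
Proof.
move=> cl cl' cK; rewrite le_eqVlt => /predU1P[->//|st].
apply/ler_addgt0Pr => e e0.
have K0 : 0 <= K by apply: le_trans (cK 0); exact: mdist_ge0.
(* Convexity over [s, s + L] gives the error K (t - s) / L <= e. *)
pose L := (t - s) * (1 + K / e).
have ts0 : 0 < t - s by rewrite subr_gt0.
have Ke : 0 <= K / e by rewrite divr_ge0// ltW.
have tsL : 0 <= t - s <= L by rewrite ltW//= ler_pMr// lerDl.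
have L0 : 0 < L by rewrite mulr_gt0//; lra.
have sN : s <= s + L by rewrite lerDl ltW.
have l01 : 0 <= (t - s) / L <= 1.
  by case/andP: tsL => h1 h2; rewrite divr_ge0 ?(ltW L0)//= ler_pdivrMr// mul1r.
have seg (d : R -> X) : is_line d -> between ((t - s) / L) (d s) (d (s + L)) (d t).
  move=> dl; have := line_segment dl sN; have -> : s + L - s = L by ring.
  by move=> /geodesic_between/(_ L0 tsL); rewrite subrK.
apply: (le_trans (dist_convex cat l01 (seg _ cl) (seg _ cl'))).
have h1 : (t - s) / L * mdist (c (s + L)) (c' (s + L)) <= (t - s) / L * K.
  by rewrite ler_wpM2l//; case/andP: l01.
have h2 : (t - s) / L * K <= e.
  rewrite mulrAC ler_pdivrMr// /L.
  have -> : e * ((t - s) * (1 + K / e)) = (t - s) * (e + K) by field; rewrite gt_eqF.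
  by rewrite ler_wpM2l ?(ltW ts0)// lerDr ltW.
have h3 : (1 - (t - s) / L) * mdist (c s) (c' s) <= mdist (c s) (c' s).
  by rewrite ler_piMl ?mdist_ge0// gerBl; case/andP: l01.
by rewrite [leRHS]addrC (le_trans (lerD h3 (le_trans h1 h2)))// addrC.
Qed.

(** The distance is nonincreasing in both directions, by the preceding inequality
    for the lines and for the reversed lines. *)
Lemma parallel_dist (c c' : R -> X) (K s t u : R) : is_line c -> is_line c' ->
  (forall t, mdist (c t) (c' t) <= K) ->
  mdist (c s) (c' (s + u)) = mdist (c t) (c' (t + u)).
Proof.
move=> cl cl' cK.
have b v : mdist (c v) (c' (v + u)) <= K + `|u|.
  apply: (le_trans (metric_triangle _ (c' v) _)); rewrite lerD// cl'//.
  by rewrite opprD addrA subrr sub0r normrN.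
have cu := line_shift u cl'.
have H := parallel_dist_le cl cu b.
have b' v : mdist (c (- v)) (c' (- v + u)) <= K + `|u| by exact: b.
have H' v w := @parallel_dist_le _ _ _ v w (line_rev cl) (line_rev cu) b'.
wlog st : s t / s <= t.
  by move=> W; have [/W|/ltW/W] := leP s t.
apply/eqP; rewrite eq_le (H _ _ st) andbT.
by have := H' (- t) (- s); rewrite lerN2 !opprK => /(_ st).
Qed.

(** Two parallel lines bound a flat strip, of which m is the middle line. The
    quadrilateral inequality bounds the sum of the two diagonals of a long thin
    parallelogram; if m were not isometric, the path from c (- N) to c N through
    the middle curve would be shorter than 2 N. *)
Lemma middle_line (c c' m : R -> X) (K : R) : is_line c -> is_line c' ->
  (forall t, mdist (c t) (c' t) <= K) ->
  (forall t, between (1 / 2) (c t) (c' t) (m t)) -> is_line m.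
Proof.
move=> cl cl' cK mP.
have l01 : 0 <= (1 / 2 : R) <= 1 by lra.
have mLip s t : mdist (m s) (m t) <= `|s - t|.
  by have := dist_convex cat l01 (mP s) (mP t); rewrite cl// cl'//; lra.
have half z t : mdist (m t) z <= 1 / 2 * mdist (c t) z + 1 / 2 * mdist (c' t) z.
  have zz : between (1 / 2) z z z by split; rewrite mdistxx mulr0.
  by have := dist_convex cat l01 (mP t) zz; lra.
have sym t : 0 <= t -> 2 * t <= mdist (m (- t)) (m t).
  move=> t0; apply/ler_addgt0Pr => e e0.
  pose a := mdist (c 0) (c' 0).
  (* The length P of the parallelogram is such that its width a contributes at
     most e to the mean of the diagonals. *)
  pose P := 1 + a ^+ 2 / e.
  have P0 : 0 < P by rewrite ltr_pwDl// divr_ge0 ?sqr_ge0// ltW.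
  pose N := t + P.
  have q := quadrilateral cat (c 0) (c P) (c' P) (c' 0).
  have e1 : mdist (c 0) (c P) = P by rewrite cl// sub0r normrN gtr0_norm.
  have e2 : mdist (c' P) (c' 0) = P by rewrite cl'// subr0 gtr0_norm.
  have e3 : mdist (c P) (c' P) = a.
    by have := parallel_dist P 0 0 cl cl' cK; rewrite !addr0.
  rewrite e1 e2 e3 (metric_sym (c' 0)) -/a in q.
  have f1 : mdist (c' (- t)) (c (- N)) = mdist (c 0) (c' P).
    rewrite metric_sym; have := parallel_dist (- N) 0 P cl cl' cK.
    by rewrite add0r (_ : - N + P = - t)// /N; ring.
  have f2 : mdist (c' t) (c N) = mdist (c P) (c' 0).
    rewrite metric_sym; have := parallel_dist N P (- P) cl cl' cK.
    by rewrite subrr (_ : N - P = t)// /N; ring.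
  have f3 : mdist (c (- t)) (c (- N)) = P.
    by rewrite cl// (_ : - t - - N = P) ?gtr0_norm// /N; ring.
  have f4 : mdist (c t) (c N) = P.
    by rewrite cl// (_ : t - N = - P) ?normrN ?gtr0_norm// /N; ring.
  have f5 : mdist (c (- N)) (c N) = 2 * N.
    by rewrite cl// (_ : - N - N = - (2 * N)) ?normrN ?ger0_norm// /N; lra.
  have h1 := half (c (- N)) (- t); have h2 := half (c N) t.
  rewrite f1 f3 in h1; rewrite f2 f4 in h2.
  have h3 := metric_triangle (c (- N)) (m (- t)) (c N).
  have h4 := metric_triangle (m (- t)) (m t) (c N).
  rewrite f5 (metric_sym (c (- N))) in h3.
  have diag : mdist (c 0) (c' P) + mdist (c P) (c' 0) <= 2 * P + 2 * e.
    apply: le_of_sqr; first by lra.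
    have Pe : a ^+ 2 <= P * e.
      by rewrite /P mulrDl divfK ?gt_eqF// mul1r lerDr ltW.
    move: (mdist (c 0) (c' P)) (mdist (c P) (c' 0)) q => x y q.
    have := sqr_ge0 (x - y); have := sqr_ge0 e; have := sqr_ge0 a; lra.
  by rewrite /N in h3 f5 *; lra.
(* Any pair s <= t is inside [-T, T], and m cannot catch up on a loss. *)
suff le s t : s <= t -> t - s <= mdist (m s) (m t).
  move=> s t _ _; apply/eqP; rewrite eq_le mLip/=.
  have [st|/ltW ts] := leP s t; first by rewrite distrC ger0_norm ?subr_ge0// le.
  by rewrite ger0_norm ?subr_ge0// metric_sym le.
move=> st; pose T := `|s| + `|t|.
have [h1 h2] : - T <= s /\ t <= T.
  have := ler_norm (- s); have := ler_norm t; rewrite normrN /T.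
  by have := normr_ge0 s; have := normr_ge0 t; split; lra.
have T0 : 0 <= T by rewrite addr_ge0.
have := sym T T0; have := metric_triangle (m (- T)) (m s) (m T).
have := metric_triangle (m s) (m t) (m T).
have := mLip (- T) s; have := mLip t T.
rewrite [`|- T - s|]distrC [`|t - T|]distrC !ger0_norm; lra.
Qed.

(** Geodesics from o to b n stay within d(o, b 0) of b. *)
Lemma exists_ray_from (o : X) (b : ray X) : exists2 e : ray X, e 0 = o & asymptotic e b.
Proof.
have [U [UU oU]] := exists_ultrafilter.
have /choice[G GP] : forall n : nat, exists g, is_geodesic o (b n%:R) (mdist o (b n%:R)) g.
  by move=> n; exact: exists_geodesic.
have gb n := ray_geodesic b (ler0n R n).
have far r : U [set n | r <= mdist o (b n%:R)].
  apply: filterS (ultra_ge oU (r + mdist (b 0) o)) => n /= h.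
  have := metric_triangle (b 0) o (b n%:R); rewrite (geodesic_length (gb n)); lra.
have [e [e0 eP]] := limit_ray proper UU GP far.
exists e => //; exists (mdist o (b 0)) => r r0.
apply: (tends_le UU (eP r r0) (tends_cst UU (b r))) => eps eps0.
apply: filterS (filterI (far (r + 1)) (ultra_ge oU r)) => n /= [rL rn].
have L0 : 0 < mdist o (b n%:R) by lra.
have rL' : 0 <= r <= mdist o (b n%:R) by apply/andP; split; lra.
have := fellow_travel cat (GP n) (gb n) L0 rL' rn.
by rewrite mdistxx mulr0 addr0; lra.
Qed.

(** A line from the endpoint of b to the endpoint of a. Bounded distances, rather
    than the endpoints of two half-lines, make it unnecessary to cut c into rays. *)
Definition joins (a b : ray X) (c : R -> X) : Prop :=
  is_line c /\ exists K : R, forall t, 0 <= t ->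
    mdist (c t) (a t) <= K /\ mdist (c (- t)) (b t) <= K.

Lemma joins_parallel a b c c' : joins a b c -> joins a b c' ->
  exists K : R, forall t, mdist (c t) (c' t) <= K.
Proof.
move=> [cl [K cK]] [cl' [K' cK']]; exists (K + K') => t.
have [t0|/ltW t0] := leP 0 t.
  apply: (le_trans (metric_triangle _ (a t) _)).
  by rewrite lerD// ?(metric_sym (a t)); [case: (cK t t0)|case: (cK' t t0)].
rewrite -oppr_ge0 in t0; have := cK _ t0; have := cK' _ t0; rewrite opprK.
move=> [_ h1] [_ h2]; apply: (le_trans (metric_triangle _ (b (- t)) _)).
by rewrite lerD// metric_sym.
Qed.

Lemma parallel_joins a b c c' (K : R) : joins a b c -> is_line c' ->
  (forall t, mdist (c' t) (c t) <= K) -> joins a b c'.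
Proof.
move=> [cl [L cL]] cl' cK; split=> //; exists (K + L) => t t0.
have [h1 h2] := cL t t0.
by split; apply: (le_trans (metric_triangle _ (c _) _)); exact: lerD.
Qed.

Lemma joins_shift a b c (u : R) : joins a b c -> joins a b (fun t => c (t + u)).
Proof.
move=> cJ; have [cl _] := cJ.
apply: (parallel_joins (K := `|u|) cJ); first exact: line_shift.
by move=> t; rewrite cl// [t + u]addrC addrK.
Qed.

Lemma joins_iso a b c (f : self_isometry X) : asymptotic (iso_ray f a) a ->
  asymptotic (iso_ray f b) b -> joins a b c -> joins a b (f \o c).
Proof.
move=> [A fa] [B fb] [cl [K cK]]; split; first by move=> s t _ _; rewrite /= iso_dist cl.
exists (K + `|A| + `|B|) => t t0; have [h1 h2] := cK t t0.
have h3 := fa t t0; have h4 := fb t t0; rewrite /= in h3 h4.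
have := metric_triangle (f (c t)) (f (a t)) (a t).
have := metric_triangle (f (c (- t))) (f (b t)) (b t).
rewrite !iso_dist /=; have := ler_norm A; have := ler_norm B.
have := normr_ge0 A; have := normr_ge0 B; split; lra.
Qed.

End Lines.

(** * Isometries fixing two endpoints *)

Section Uniqueness.
Context {R : realType} {X : metricType R}.
Hypotheses (proper : proper_space X) (cat : CAT0 X) (vis : visible X).
Variables (a b : ray X).
Hypotheses (ba : b 0 = a 0) (nba : endpoint b <> endpoint a).

(** The geodesics from b (T n) to a (T n) meet a fixed ball; parametrized from a
    point in it, they have a limit line. *)
Lemma exists_joining_line : exists c, joins a b c.
Proof.
have [N NP] := visibility proper cat vis ba nba.
have [U [UU oU]] := exists_ultrafilter.
pose T (n : nat) := n%:R + N.+1%:R : R.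
have N0 : 0 < N.+1%:R :> R by rewrite ltr0n.
have TN n : N.+1%:R <= T n by rewrite lerDr.
have T0 n : 0 <= T n by rewrite (le_trans _ (TN n)).
have /choice[g gP] : forall n, exists g,
    is_geodesic (b (T n)) (a (T n)) (mdist (b (T n)) (a (T n))) g.
  by move=> n; exact: exists_geodesic.
pose L n := mdist (b (T n)) (a (T n)).
have /choice[t tP] : forall n, exists t, 0 <= t <= L n /\ mdist (b 0) (g n t) <= N.+1%:R.
  move=> n; have TN0 : 0 <= T n / N.+1%:R by rewrite divr_ge0.
  have [t tL tN] := NP (T n) _ _ _ _ (TN n) (eq_ind_r (fun z => z <= _) TN0 (mdistxx _))
    (eq_ind_r (fun z => z <= _) TN0 (mdistxx _)) (gP n).
  by exists t.
have gb n := ray_geodesic b (T0 n); have ga n := ray_geodesic a (T0 n).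
have gh n := geodesic_head_rev (gP n) (tP n).1.
have gt n := geodesic_tail (gP n) (tP n).1.
have tn n : n%:R <= t n.
  have := metric_triangle (b 0) (g n (t n)) (b (T n)).
  by rewrite (geodesic_length (gb n)) (geodesic_length (gh n)); case: (tP n); rewrite /T; lra.
have Ltn n : n%:R <= L n - t n.
  have := metric_triangle (a 0) (g n (t n)) (a (T n)).
  rewrite (geodesic_length (ga n)) (geodesic_length (gt n)) -ba.
  by case: (tP n); rewrite /T /L; lra.
have inside n s : `|s| <= n%:R -> 0 <= s + t n <= L n.
  have := tn n; have := Ltn n; rewrite ler_norml => h1 h2 /andP[h3 h4].
  by apply/andP; split; lra.
pose sg n s := g n (s + t n).
have sgd n s u : `|s| <= n%:R -> `|u| <= n%:R -> mdist (sg n s) (sg n u) = `|s - u|.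
  move=> hs hu; have [_ gi _ _] := gP n.
  by rewrite /sg (iso_segment gi) ?inside//; congr `| _ |; ring.
have [||c [cl cP]] := @limit_curve _ _ proper U UU setT sg (b 0).
- move=> s _; exists (N.+1%:R + `|s|); apply: filterS (ultra_ge oU `|s|) => n /= sn.
  apply: (le_trans (metric_triangle _ (sg n 0) _)); rewrite lerD//.
    by rewrite /sg add0r; case: (tP n).
  by rewrite sgd ?normr0// sub0r normrN.
- move=> s u _ _; apply: filterS (filterI (ultra_ge oU `|s|) (ultra_ge oU `|u|)).
  by move=> n /= [sn un]; exact: sgd.
exists c; split=> //; exists N.+1%:R => r r0; split.
- apply: (tends_le UU (cP r I) (tends_cst UU (a r))) => e e0.
  apply: filterS (ultra_ge oU (r + 1)) => n /= rn.
  have := fellow_travel cat (gt n) (ga n) (r := r).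
  rewrite mdistxx mulr0 addr0 -ba (metric_sym (g n (t n)) (b 0)).
  have := Ltn n; have := TN n; have := tP n; rewrite /T /L /sg => h1 h2 h3 h4.
  by apply: (le_trans (h4 _ _ _)); rewrite ?r0/=; lra.
- apply: (tends_le UU (cP (- r) I) (tends_cst UU (b r))) => e e0.
  apply: filterS (ultra_ge oU (r + 1)) => n /= rn.
  have := fellow_travel cat (gh n) (gb n) (r := r).
  rewrite mdistxx mulr0 addr0 (metric_sym (g n (t n)) (b 0)) /sg (addrC (- r)).
  have := tn n; have := TN n; have := tP n; rewrite /T /L => h1 h2 h3 h4.
  by apply: (le_trans (h4 _ _ _)); rewrite ?r0/=; try lra.
Qed.

(** Far enough on the line, the distances from the two rays are small relative to
    the parameter T, whatever the distance of the line from b 0. *)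
Lemma joining_lines_meet_ball : exists N : R, forall c, joins a b c ->
  exists t, mdist (b 0) (c t) <= N.
Proof.
have [N NP] := visibility proper cat vis ba nba.
exists N.+1%:R => c [cl [K cK]].
pose T := N.+1%:R * (`|K| + 1).
have N1 : 1 <= N.+1%:R :> R by rewrite ler1n.
have N0 : 0 < N.+1%:R :> R by rewrite ltr0n.
have TN : N.+1%:R <= T by rewrite ler_peMr ?(ltW N0)// lerDr.
have T0 : 0 <= T by rewrite (le_trans _ TN)// ltW.
have TK : K <= T / N.+1%:R.
  by rewrite /T mulrC mulKf ?gt_eqF//; have := ler_norm K; lra.
have [h1 h2] := cK T T0.
have TT : - T <= T by lra.
have [t _ tN] := NP T _ _ _ _ TN (le_trans h2 TK) (le_trans h1 TK) (line_segment cl TT).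
by exists (t + - T).
Qed.

(** The union of the lines from the endpoint of b to the endpoint of a is
    midpoint closed and invariant, displacement is constant along each line, and
    each line meets a fixed compact ball. So displacement attains a minimum. *)
Lemma two_fixed_endpoints_semisimple (f : self_isometry X) :
  asymptotic (iso_ray f a) a -> asymptotic (iso_ray f b) b ->
  elliptic f \/ hyperbolic f.
Proof.
move=> fa fb; pose S := [set x | exists2 c, joins a b c & c 0 = x].
have [N NP] := joining_lines_meet_ball.
have [U [UU oU]] := exists_ultrafilter.
have [l lJ] := exists_joining_line.
have fS x : S x -> S (f x).
  by move=> [c cJ <-]; exists (f \o c) => //; exact: joins_iso.
have mS : midpoint_closed S.
  move=> _ _ [c cJ <-] [c' cJ' <-].
  have [K cK] := joins_parallel cJ cJ'.
  have l01 : 0 <= (1 / 2 : R) <= 1 by lra.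
  have /choice[m mP] : forall t, exists m, between (1 / 2) (c t) (c' t) m.
    by move=> t; exact: exists_between.
  exists (m 0); last exact: mP.
  exists m => //; apply: (parallel_joins (K := K) cJ).
    exact: (middle_line cat cJ.1 cJ'.1 cK mP).
  move=> t; rewrite metric_sym (mP t).1.
  by have := cK t; have := mdist_ge0 (c t) (c' t); lra.
have [|p [c cJ <-]|u x uS uN ux|p Sp pmin] :=
  @exists_minimal_displacement _ _ proper f S U UU oU (b 0) N.
- by exists (l 0), l.
- have [t ct] := NP c cJ; exists (c t); split=> //.
    by exists (fun s => c (s + t)); [exact: joins_shift|rewrite add0r].
  have [K cK] := joins_parallel cJ (joins_iso fa fb cJ).
  have := parallel_dist cat t 0 0 cJ.1 (joins_iso fa fb cJ).1 cK.
  by rewrite /= !addr0 => ->.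
- have /choice[c cP] : forall n, exists c, joins a b c /\ c 0 = u n.
    by move=> n; have [c ? ?] := uS n; exists c.
  have [||d [dl dP]] := @limit_curve _ _ proper U UU setT c (b 0).
  + move=> s _; exists (N + `|s|); apply: ultra_all => n /=.
    apply: (le_trans (metric_triangle _ (u n) _)); rewrite lerD//.
    by rewrite -(cP n).2 (cP n).1.1// sub0r normrN.
  + by move=> s t _ _; apply: ultra_all => n /=; rewrite (cP n).1.1.
  exists d; last first.
    apply: mdist_positivity; apply/eqP; rewrite eq_le mdist_ge0 andbT.
    apply: (tends_le UU (dP 0 I) ux) => e e0; apply: ultra_all => n /=.
    by rewrite (cP n).2 mdistxx add0r ltW.
  apply: (parallel_joins (K := N + mdist (b 0) (l 0)) lJ) => // t.
  apply: (tends_le UU (dP t I) (tends_cst UU (l t))) => e e0.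
  apply: ultra_all => n /=; have [K cK] := joins_parallel (cP n).1 lJ.
  have := parallel_dist cat t 0 0 (cP n).1.1 lJ.1 cK; rewrite !addr0 => ->.
  rewrite (cP n).2; have := metric_triangle (u n) (b 0) (l 0).
  by rewrite (metric_sym (u n) (b 0)); have := uN n; lra.
exact: (minimal_displacement_semisimple cat fS mS Sp pmin).
Qed.

End Uniqueness.

Theorem corollary1p2 (R : realType) (X : metricType R) (f : self_isometry X)
    (hX0 : [set: X] !=set0)
    (hXproper : proper_space X)
    (hXcat : CAT0 X)
    (hSigma : forall p : X, compact [set: space_of_directions p])
    (hf : parabolic f)
    (hvis : visible X) :
  exists x : ideal_boundary X, fixed_at_infinity f = [set x].
Proof.
case: hX0 => o _.
have fixedE (c : ray X) :
    fixed_at_infinity f (endpoint c) <-> asymptotic (iso_ray f c) c.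
  by rewrite /fixed_at_infinity/= iso_boundaryE; exact: endpoint_eq.
have from_o (x : ideal_boundary X) : exists2 c : ray X, c 0 = o & endpoint c = x.
  have [c c0 /endpoint_eq cx] := exists_ray_from hXproper hXcat o (repr x).
  by exists c; rewrite // cx /endpoint reprK.
have [c /fixedE cfix] := parabolic_fixes_ray hXproper hXcat o hf.
exists (endpoint c); apply/seteqP; split=> [y yfix|_ ->//].
apply: contrapT => /= yc.
have [a a0 aE] := from_o (endpoint c); have [b b0 bE] := from_o y.
rewrite -aE in cfix yc; rewrite -bE in yfix yc; move: cfix yfix => /fixedE cfix /fixedE yfix.
have ba : b 0 = a 0 by rewrite a0.
have [nell nhyp] := hf.
have := two_fixed_endpoints_semisimple hXproper hXcat hvis ba yc.
by case/(_ f cfix yfix).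
Qed.
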